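(* Consider the regression model $Y_i=\mathbf 1(X_i\in G)+\xi_i$, $i=1,\dots,n$, with design (DD) or (RD), where the noise terms $\xi_i$ are i.i.d. centered Gaussian random variables with variance $\sigma^2>0$, independent of the design. The minimax risk on the class $\mathcal S=\{[a,b]:0\le a\le b\le1\}$ satisfies, asymptotically, $$\mathcal R_n(\mathcal S)\asymp_\sigma\frac{\ln n}{n},$$ i.e. there exist positive constants $c(\sigma),C(\sigma)$ depending only on $\sigma$ such that $c(\sigma)\frac{\ln n}{n}\le\mathcal R_n(\mathcal S)\le C(\sigma)\frac{\ln n}{n}$ for all $n$ large enough.
   Context: Model: one observes $(X_1,Y_1),\dots,(X_n,Y_n)$ with $Y_i=\mathbf 1(X_i\in G)+\xi_i$, where $G\subseteq[0,1]$ is an unknown segment. $\mathbb E_G$ is expectation when the segment is $G$. Designs: (DD) $X_i=i/n$, $i=1,\dots,n$; (RD) $X_1\le\dots\le X_n$ is the increasing reordering of $n$ i.i.d. uniform random variables on $[0,1]$. An estimator $\hat G_n$ is a (possibly empty) segment in $[0,1]$ constructed measurably from the $n$ observations. For a class $\mathcal C$ of segments, $\mathcal R_n(\hat G_n;\mathcal C)=\sup_{G\in\mathcal C}\mathbb E_G[|G\triangle\hat G_n|]$, where $|\cdot|$ is Lebesgue measure and $\triangle$ is symmetric difference; the minimax risk is $\mathcal R_n(\mathcal C)=\inf_{\tilde G_n}\mathcal R_n(\tilde G_n;\mathcal C)$, the infimum being over all estimators based on $n$ observations. *)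

(* Defs.v *)
From HB Require Import structures.
From mathcomp Require Import all_boot all_order all_algebra.
From mathcomp Require Import all_classical all_reals all_analysis.

Set Implicit Arguments.
Unset Strict Implicit.
Unset Printing Implicit Defensive.

Import Order.TTheory GRing.Theory Num.Theory.
Import numFieldNormedType.Exports.

Local Open Scope classical_set_scope.
Local Open Scope ring_scope.
Local Open Scope ereal_scope.

Section independence.
Context {d} {T : measurableType d} {R : realType} (P : probability T R).

(* The family is finite and some of the [B i] may be [setT], so this is the
   product rule for all its subfamilies. *)
Definition mutually_independent {d'} {T' : measurableType d'} (n : nat)
    (Z : 'I_n -> T -> T') : Prop :=
  forall B : 'I_n -> set T', (forall i, measurable (B i)) ->
    P (\bigcap_(i in [set: 'I_n]) (Z i @^-1` B i)) =
    \prod_(i < n) P (Z i @^-1` B i).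

Definition independent2 {d1 d2} {T1 : measurableType d1}
    {T2 : measurableType d2} (f : T -> T1) (g : T -> T2) : Prop :=
  forall A B, measurable A -> measurable B ->
    P ((f @^-1` A) `&` (g @^-1` B)) = P (f @^-1` A) * P (g @^-1` B).

(* The laws are compared on Borel sets only: the value of a measure on a
   non-measurable set is meaningless. *)
Definition iid_with_law (n : nat) (Z : 'I_n -> {RV P >-> R})
    (mu : set R -> \bar R) : Prop :=
  (forall i (A : set R), measurable A -> distribution P (Z i) A = mu A) /\
  mutually_independent Z.

End independence.

Section model.
Context {R : realType}.

Definition joint {T U : Type} {n : nat} (Z : 'I_n -> T -> U) (w : T) :
    n.-tuple U := [tuple Z i w | i < n].

(* Indices run over 0, ..., n - 1, hence the shift. *)
Definition deterministic_design {d} {T : measurableType d}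
    (P : probability T R) (n : nat) (X : 'I_n -> {RV P >-> R}) : Prop :=
  forall i w, X i w = (i.+1%:R / n%:R)%R.

Definition random_design {d} {T : measurableType d}
    (P : probability T R) (n : nat) (X : 'I_n -> {RV P >-> R}) : Prop :=
  exists U : 'I_n -> {RV P >-> R},
    iid_with_law U (uniform_prob (@ltr01 R)) /\
    forall w, joint X w = sort <=%R (joint U w) :> seq R.

Definition observations {T : Type} (n : nat) (X xi : 'I_n -> T -> R)
    (G : set R) : T -> n.-tuple (R * R) :=
  joint (fun i w => (X i w, \1_G (X i w) + xi i w)%R).

(* [b z < a z] encodes the empty segment. *)
Definition estimator {n : nat} : set (n.-tuple (R * R) -> set R) :=
  [set Ghat | (exists a b : n.-tuple (R * R) -> R,
      [/\ measurable_fun setT a, measurable_fun setT b &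
          forall z, Ghat z = `[a z, b z]%classic]) /\
    forall z, Ghat z `<=` `[0%R, 1%R]%classic].

Definition segments : set (set R) :=
  [set G | exists a b : R, [/\ (0 <= a)%R, (a <= b)%R, (b <= 1)%R &
    G = `[a, b]%classic]].

Section risk.
Context {d} {T : measurableType d} (P : probability T R).
Context {n : nat} (X xi : 'I_n -> {RV P >-> R}).

Definition expected_loss (Ghat : n.-tuple (R * R) -> set R) (G : set R) :
    \bar R :=
  \int[P]_w lebesgue_measure (G `+` Ghat (observations X xi G w)).

Definition risk (Ghat : n.-tuple (R * R) -> set R) (C : set (set R)) :
    \bar R :=
  ereal_sup [set expected_loss Ghat G | G in C].

Definition minimax_risk (C : set (set R)) : \bar R :=
  ereal_inf [set risk Ghat C | Ghat in estimator].

End risk.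
End model.

(* Main.v *)
Require Import Defs.
From HB Require Import structures.
From mathcomp Require Import all_boot all_order all_algebra.
From mathcomp Require Import ring lra.
From mathcomp Require Import all_classical all_reals all_analysis.
From mathcomp Require Import measurable_realfun.

(* Lower bound. Split [0, 1] into segments [G_k] of length [delta] of order
   [ln n / n]. Gaussian shifts have explicit likelihood ratios, so the laws of
   the data under the [G_k] have densities [L_k] with respect to the law of pure
   noise, and [E L_k ^ 2 <= exp (kappa * (n * delta + 1))]. The events "the left
   endpoint of the estimator is within [delta / 2] of that of [G_k]" are
   disjoint; changing measure and using [L <= t + L ^ 2 / t], their
   probabilities under the respective [G_k] add up to at most half the number
   of segments. Hence for some [k] the event fails with probability at least
   [1 / 2], and when it fails the loss is at least [delta / 2].

   Upper bound. Among the segments [K] with endpoints in [{0, 1/n, ..., 1}],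
   take one maximizing [S K], the sum of [2 Y_i - 1] over the [X_i] in [K]. If
   [G'] is the best grid approximation of [G] from inside, then
   [E exp (lam * (S K - S G'))] is at most a constant times
   [exp (- kappa * n * |K + G'|)], [+] being the symmetric difference; summing
   over the [(n + 1) ^ 2] candidates bounds [E exp (kappa * n * |K + G'|)] for
   the maximizer [K], and this exponential moment controls the mean.

   For both designs the randomness of [X] only enters through the bound
   [E prod_i (1 + h (X_i)) <= exp (n * int h + const)] for step functions [h]. *)

Set Implicit Arguments.
Unset Strict Implicit.
Unset Printing Implicit Defensive.

Import Order.TTheory GRing.Theory Num.Theory.
Import numFieldNormedType.Exports.

Local Open Scope classical_set_scope.
Local Open Scope ring_scope.

(** * Integrals of nonnegative functions, boxes of tuples, independence on pi-systems *)

Section monotone_integral.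
Context d (T : measurableType d) (R : realType).
Variable mu : {measure set T -> \bar R}.
Local Open Scope ereal_scope.

Import HBNNSimple.

(* Unlike [ge0_le_integral], nothing is required to be measurable. *)
Lemma ge0_le_integralT (f g : T -> \bar R) :
  (forall x, 0 <= f x) -> (forall x, f x <= g x) ->
  \int[mu]_x f x <= \int[mu]_x g x.
Proof.
move=> f0 fg; have g0 x : 0 <= g x := le_trans (f0 x) (fg x).
rewrite !ge0_integralTE//; apply: ereal_sup_le => _ [h hf <-].
by exists h => // x; exact: le_trans (fg x).
Qed.

End monotone_integral.

Section tuple_boxes.
Context d (T : measurableType d) (n : nat).

(** A pi-system generating the product sigma-algebra. Measures on tuples are compared on it, because
    indicators of boxes factor over the coordinates. *)
Definition boxes : set (set (n.-tuple T)) :=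
  [set A | exists2 B : 'I_n -> set T, forall i, measurable (B i) &
    A = [set t | forall i, B i (tnth t i)]].

Lemma boxes_setT : boxes setT.
Proof. by exists (fun=> setT) => //; apply/seteqP; split. Qed.

Lemma setI_closed_boxes : setI_closed boxes.
Proof.
move=> _ _ [A mA ->] [B mB ->]; exists (fun i => A i `&` B i).
  by move=> i; exact: measurableI.
apply/seteqP; split => t /=; first by move=> [At Bt] i; split.
by move=> ABt; split => i; have [] := ABt i.
Qed.

Lemma measurable_boxes : measurable `<=` <<s boxes >>.
Proof.
apply: smallest_sub; first exact: smallest_sigma_algebra.
move=> A; rewrite -bigcup_seq/= => -[i _ [B mB <-]].
apply: sub_sigma_algebra.
exists (fun j => if j == i then B else setT); first by move=> j; case: ifP.
rewrite setTI; apply/seteqP; split => t /= H.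
  by move=> j; case: eqP => [->|].
by have := H i; rewrite eqxx.
Qed.

Lemma boxes_measurable : boxes `<=` measurable.
Proof.
move=> _ [B mB ->].
rewrite (_ : [set _ | _] =
    \big[setI/setT]_(i < n) ((fun t => tnth t i) @^-1` B i)); last first.
  rewrite -bigcap_seq; apply/seteqP; split => t /= H i; last first.
    by apply: H => /=; rewrite mem_index_enum.
  by move=> _; exact: H.
apply: bigsetI_measurable => i _; rewrite -[X in measurable X]setTI.
exact: measurable_tnth.
Qed.

Lemma measurable_boxesE : measurable = <<s boxes >>.
Proof.
apply/seteqP; split; first exact: measurable_boxes.
apply: smallest_sub; first exact: sigma_algebra_measurable.
exact: boxes_measurable.
Qed.

End tuple_boxes.

Section independence_pi_system.
Context d (T : measurableType d) (R : realType) (P : probability T R).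
Context d' (T' : measurableType d').
Local Open Scope ereal_scope.

(** Both sides are finite measures in [A]: the image under [Z] of [P] restricted to [E], and a
    multiple of the law of [Z]. They agree on a generating pi-system, hence everywhere. *)
Lemma pi_system_independent (G : set (set T')) (Z : T -> T') (E : set T) :
  measurable = <<s G >> -> setI_closed G -> G setT ->
  measurable_fun setT Z -> measurable E ->
  (forall A, G A -> P (Z @^-1` A `&` E) = P (Z @^-1` A) * P E) ->
  forall A, measurable A -> P (Z @^-1` A `&` E) = P (Z @^-1` A) * P E.
Proof.
move=> mG IG GT mZ mE GE A mA.
have PEnn : (0 <= fine (P E))%R by exact: fine_ge0.
pose c := NngNum PEnn.
have PEc : P E = c%:num%:E by rewrite /= fineK// fin_num_measure.
pose m1 : {measure set T' -> \bar R} := pushforward (mrestr P mE) Z.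
pose m2 : {measure set T' -> \bar R} := mscale c (pushforward P Z).
have : m1 mZ A = m2 mZ A.
  apply: (measure_unique G (fun=> setT)) => //.
  - by apply/seteqP; split => // x _; exists 0%N.
  - move=> B GB; rewrite /m1 /m2 /mscale /= /pushforward /mrestr.
    by rewrite GE// PEc muleC.
  - move=> _; rewrite /m1 /= /pushforward /mrestr.
    by rewrite preimage_setT setTI (le_lt_trans (probability_le1 _ _)) ?ltry.
by rewrite /m1 /m2 /mscale /= /pushforward /mrestr => ->; rewrite PEc muleC.
Qed.

End independence_pi_system.

(** * Product laws *)

Section freezing.
Context d (T : measurableType d) (R : realType) (P : probability T R).
Context d1 (T1 : measurableType d1) d2 (T2 : measurableType d2).
Variable mu : probability T2 R.
Local Open Scope ereal_scope.

(** The hypothesis on rectangles identifies the law of the pair with a product measure; Tonelli's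
    theorem does the rest. *)
Lemma integral_independent (Z : T -> T1) (V : T -> T2)
    (F : T1 * T2 -> \bar R) :
  measurable_fun setT Z -> measurable_fun setT V ->
  (forall A B, measurable A -> measurable B ->
    P (Z @^-1` A `&` V @^-1` B) = P (Z @^-1` A) * mu B) ->
  measurable_fun [set: T1 * T2] F -> (forall z, 0 <= F z) ->
  \int[P]_w F (Z w, V w) = \int[P]_w \int[mu]_y F (Z w, y).
Proof.
move=> mZ mV ZV mF F0.
have mZV : measurable_fun setT (fun w => (Z w, V w)).
  exact: measurable_fun_pair.
pose Z_mixin := isMeasurableFun.Build _ _ _ _ _ mZ.
pose Zm : {mfun T >-> T1} := HB.pack Z Z_mixin.
pose ZV_mixin := isMeasurableFun.Build _ _ _ _ _ mZV.
pose ZVm : {mfun T >-> (T1 * T2)%type} :=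
  HB.pack (fun w => (Z w, V w)) ZV_mixin.
have lawE A : measurable A ->
    (distribution P Zm \x mu) A = distribution P ZVm A.
  by apply: product_measure_unique => B C mB mC; exact: ZV.
transitivity (\int[distribution P ZVm]_z F z).
  by rewrite ge0_integral_distribution.
transitivity (\int[distribution P Zm \x mu]_z F z).
  by apply: eq_measure_integral => A mA _; apply/esym/lawE.
rewrite fubini_tonelli1// ge0_integral_distribution//.
- exact: (measurable_fun_fubini_tonelli_F F).

- by move=> x; exact: integral_ge0.
Qed.

End freezing.

Section tensor.
Context d (T : measurableType d) (R : realType) (P : probability T R).
Context (n : nat) (X xi : 'I_n -> {RV P >-> R}) 
  (mu : probability (measurableTypeR R) R).
Hypothesis xi_mu : iid_with_law xi mu.
Hypothesis Xxi : independent2 P (joint X) (joint xi).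
Local Open Scope ereal_scope.

Lemma measurable_joint (Z : 'I_n -> {RV P >-> R}) :
  measurable_fun setT (joint Z).
Proof.
apply/measurable_fun_tnthP => i; rewrite (_ : _ \o _ = Z i)//.
by apply/funext => w /=; rewrite tnth_mktuple.
Qed.

(** Setting coordinate [i] to [0] forgets it without changing the length of the tuple. *)
Definition zeroed (i : 'I_n) (t : n.-tuple R) : n.-tuple R :=
  [tuple if j == i then 0%R else tnth t j | j < n].

Lemma measurable_zeroed i : measurable_fun setT (zeroed i).
Proof.
apply/measurable_fun_tnthP => j.
rewrite (_ : _ \o _ = fun t => if j == i then 0%R else tnth t j); last first.
  by apply/funext => w /=; rewrite tnth_mktuple.
by case: (j == i); [exact: measurable_cst|exact: measurable_tnth].
Qed.

Lemma zeroed_independent i (C : set (n.-tuple R)) (B : set R) :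
  measurable C -> measurable B ->
  P ((zeroed i \o joint xi) @^-1` C `&` xi i @^-1` B) =
  P ((zeroed i \o joint xi) @^-1` C) * mu B.
Proof.
move=> mC mB; have [xi_law xi_ind] := xi_mu.
have mxiB : measurable (xi i @^-1` B).
  by rewrite -[X in measurable X]setTI; exact: measurable_funP.
rewrite -(xi_law i B)//.
apply: (pi_system_independent (G := @boxes _ R n)) => //.
- exact: measurable_boxesE.
- exact: setI_closed_boxes.
- exact: boxes_setT.
- by apply: measurableT_comp; [exact: measurable_zeroed|exact: measurable_joint].
move=> _ [D mD ->].
have mcst (b : R) j : measurable (fun _ : R => D j b).
  have [Db|Db] := pselect (D j b).
    rewrite [X in _ X](_ : _ = setT)//; apply/seteqP; by split.
  rewrite [X in _ X](_ : _ = set0)//; apply/seteqP; split => // x /=.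
(* Coordinate [i] of a zeroed tuple is always [0], so its side of the box becomes a constant
   condition: the whole line or nothing. *)
pose E j := if j == i then (fun _ : R => D i 0%R) : set R else D j.
have mE j : measurable (E j) by rewrite /E; case: ifP.
have preE : (zeroed i \o joint xi) @^-1` [set t | forall j, D j (tnth t j)] =
    \bigcap_(j in [set: 'I_n]) (xi j @^-1` E j).
  apply/seteqP; split => w /= H.
    move=> j _; have := H j; rewrite !tnth_mktuple /E /=.
    by case: eqP => [->|].
  move=> j; have := H j I; rewrite !tnth_mktuple /E /=.
  by case: eqP => [->|].
pose E' j := E j `&` if j == i then B else setT.
have mE' j : measurable (E' j).
  by rewrite /E'; apply: measurableI => //; case: ifP.
have preE' : \bigcap_(j in [set: 'I_n]) (xi j @^-1` E j) `&` xi i @^-1` B =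
    \bigcap_(j in [set: 'I_n]) (xi j @^-1` E' j).
  apply/seteqP; split => w.
    move=> [H Bw] j _; split; first exact: H.
    by case: eqP => [->|].
  move=> H; split => [j _|]; first by have [] := H j I.
  by have [_] := H i I; rewrite /= eqxx.
rewrite preE preE' !xi_ind//.
rewrite (bigD1 i)//= [X in _ = X * _](bigD1 i)//= -/(distribution P _ _).
rewrite [X in _ * X = _](eq_bigr (fun j => P (xi j @^-1` E j))); last first.
  by move=> j ji; rewrite /E' (negbTE ji) setIT.
rewrite [RHS]muleAC; congr (_ * _).
rewrite /E' /E eqxx preimage_setI.
have [D0|D0] := pselect (D i 0%R).
  rewrite (_ : xi i @^-1` (fun=> D i 0%R) = setT); last first.
    by apply/seteqP; split.
  by rewrite setTI probability_setT mul1e.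
rewrite (_ : xi i @^-1` (fun=> D i 0%R) = set0); last first.
  by apply/seteqP; split.
by rewrite set0I measure0 mul0e.
Qed.

(** Rectangles suffice. On them, independence of [X] and [xi] splits off the design, and
    [zeroed_independent] treats the remaining noise factor. *)
Lemma joint_zeroed_independent i (A : set (n.-tuple R * n.-tuple R))
    (B : set R) :
  measurable A -> measurable B ->
  P ((fun w => (joint X w, zeroed i (joint xi w))) @^-1` A `&` xi i @^-1` B) =
  P ((fun w => (joint X w, zeroed i (joint xi w))) @^-1` A) * mu B.
Proof.
move=> mA mB; have [xi_law xi_ind] := xi_mu.
have mxiB : measurable (xi i @^-1` B).
  by rewrite -[X in measurable X]setTI; exact: measurable_funP.
rewrite -(xi_law i B)//.
apply: (pi_system_independent
    (G := [set C `*` D | C in measurable & D in measurable])) => //.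
- exact: measurable_prod_measurableType.
- move=> _ _ [C1 mC1 [D1 mD1 <-]] [C2 mC2 [D2 mD2 <-]].
  exists (C1 `&` C2); first exact: measurableI.
  exists (D1 `&` D2); first exact: measurableI.
  by rewrite setXI.
- by exists setT => //; exists setT => //; rewrite setXTT.
- apply: measurable_fun_pair; first exact: measurable_joint.
  by apply: measurableT_comp; [exact: measurable_zeroed|exact: measurable_joint].
move=> _ [C mC [D mD <-]].
have mZD : measurable (zeroed i @^-1` D).
  by rewrite -[X in measurable X]setTI; exact: measurable_zeroed.
have mZB : measurable ((fun t : n.-tuple R => tnth t i) @^-1` B).
  by rewrite -[X in measurable X]setTI; exact: measurable_tnth.
rewrite [X in P (X `&` _)](_ : _ =
  joint X @^-1` C `&` joint xi @^-1` (zeroed i @^-1` D))//.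
rewrite [in RHS](_ : _ @^-1` (C `*` D) =
  joint X @^-1` C `&` joint xi @^-1` (zeroed i @^-1` D))//.
rewrite (Xxi mC mZD) -setIA (_ : joint xi @^-1` (zeroed i @^-1` D) `&` _ =
  joint xi @^-1` (zeroed i @^-1` D `&` (fun t => tnth t i) @^-1` B)); last first.
  by apply/seteqP; split => w /=; rewrite tnth_mktuple.
rewrite Xxi//; last exact: measurableI.
rewrite -muleA; congr (_ * _).
rewrite [X in _ = _ * X](xi_law i B mB).
rewrite -zeroed_independent//; congr (P _).
by apply/seteqP; split => w /=; rewrite tnth_mktuple.
Qed.

Lemma measurable_prod_tnth (phi : 'I_n -> R * R -> \bar R) (r : seq 'I_n)
    (Q : pred 'I_n) :
  (forall j, measurable_fun setT (phi j)) ->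
  measurable_fun setT (fun z : n.-tuple R * n.-tuple R =>
    \prod_(j <- r | Q j) phi j (tnth z.1 j, tnth z.2 j)).
Proof.
move=> mphi; elim: r => [|j r IH].
  by under eq_fun do rewrite big_nil; exact: measurable_cst.
under eq_fun do rewrite big_cons.
case: (Q j) => //; apply: emeasurable_funM => //.
apply: (measurableT_comp (mphi j)); apply: measurable_fun_pair => /=.
  exact: (measurableT_comp (measurable_tnth j) measurable_fst).
exact: (measurableT_comp (measurable_tnth j) measurable_snd).
Qed.

(* Freezing everything but [xi i], which is independent of the rest. *)
Lemma integral_prod_coordinate (phi : 'I_n -> R * R -> \bar R) i :
  (forall j, measurable_fun setT (phi j)) -> (forall j z, 0 <= phi j z) ->
  \int[P]_w \prod_(j < n) phi j (X j w, xi j w) =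
  \int[P]_w (\int[mu]_y phi i (X i w, y) *
             \prod_(j < n | j != i) phi j (X j w, xi j w)).
Proof.
move=> mphi phi0.
pose F (z : (n.-tuple R * n.-tuple R) * R) :=
  phi i (tnth z.1.1 i, z.2) *
  \prod_(j < n | j != i) phi j (tnth z.1.1 j, tnth z.1.2 j).
pose Z w := (joint X w, zeroed i (joint xi w)).
have mxi : measurable_fun setT (xi i) by exact: measurable_funP.
have FE w y : F (Z w, y) = phi i (X i w, y) *
    \prod_(j < n | j != i) phi j (X j w, xi j w).
  rewrite /F /= tnth_mktuple; congr (_ * _); apply: eq_bigr => j /negbTE ji.
  by rewrite !tnth_mktuple ji.
transitivity (\int[P]_w F (Z w, xi i w)).
  by apply: eq_integral => w _; rewrite FE (bigD1 i).
rewrite (integral_independent (mu := mu)).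
- apply: eq_integral => w _; under eq_integral do rewrite FE.
  rewrite ge0_integralZr//.
  + apply: (measurableT_comp (mphi i)); exact: measurable_fun_pair.
  + exact: prode_ge0.
- apply: measurable_fun_pair; first exact: measurable_joint.
  by apply: measurableT_comp; [exact: measurable_zeroed|exact: measurable_joint].
- exact: mxi.
- by move=> A B mA mB; exact: joint_zeroed_independent.
- apply: emeasurable_funM.
    apply: (measurableT_comp (mphi i)); apply: measurable_fun_pair => //=.
    apply: (measurableT_comp (measurable_tnth i)).
    exact: measurableT_comp.
  apply: (measurableT_comp (measurable_prod_tnth _ _ mphi) measurable_fst).
- by move=> z; apply: mule_ge0 => //; exact: prode_ge0.
Qed.

(** This is conditioning on the design: the noise is integrated out and only the randomness of [X]
    remains. *)
Lemma integral_prod_independent (phi : 'I_n -> R * R -> \bar R) :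
  (forall j, measurable_fun setT (phi j)) -> (forall j z, 0 <= phi j z) ->
  \int[P]_w \prod_(j < n) phi j (X j w, xi j w) =
  \int[P]_w \prod_(j < n) \int[mu]_y phi j (X j w, y).
Proof.
move=> mphi phi0.
pose psi j (z : R * R) : \bar R := \int[mu]_y phi j (z.1, y).
have mpsi j : measurable_fun setT (psi j).
  apply: (measurableT_comp (f := fun x => \int[mu]_y phi j (x, y))) => //.
  exact: (@measurable_fun_fubini_tonelli_F _ _ R (measurableTypeR R) R mu
    (phi j) (mphi j) (phi0 j)).
have psi0 j z : 0 <= psi j z by exact: integral_ge0.
(* Hybrid of the two sides, with the noise of the first [m] coordinates already integrated out; each
   step treats one more coordinate. *)
pose mix m (j : 'I_n) := if (j < m)%N then psi j else phi j.
have mmix m j : measurable_fun setT (mix m j) by rewrite /mix; case: ifP.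
have mix0 m j z : 0 <= mix m j z by rewrite /mix; case: ifP.
have step m : (m <= n)%N -> \int[P]_w \prod_(j < n) phi j (X j w, xi j w) =
    \int[P]_w \prod_(j < n) mix m j (X j w, xi j w).
  elim: m => [_|m IH mn]; first by apply: eq_integral => w _; apply: eq_bigr.
  rewrite IH; last exact: ltnW.
  rewrite (integral_prod_coordinate (Ordinal mn))//.
  apply: eq_integral => w _; rewrite [RHS](bigD1 (Ordinal mn))//=.
  congr (_ * _).
    by rewrite /mix /= ltnSn; under eq_integral do rewrite ltnn.
  apply: eq_bigr => j jm; rewrite /mix ltnS [(j <= m)%N]leq_eqVlt.
  rewrite (_ : (j == m :> nat) = false)//; apply: contra_neqF jm => /eqP jm.
  exact/val_inj.
rewrite (step n)//; apply: eq_integral => w _; apply: eq_bigr => j _.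
by rewrite /mix ltn_ord.
Qed.

End tensor.

(** * Gaussian shifts *)

Section density.
Context d (T : measurableType d) (R : realType).
Variables (mu : {measure set T -> \bar R}) (p : T -> \bar R).
Hypotheses (p0 : forall x, (0 <= p x)%E) (mp : measurable_fun setT p).
Local Open Scope ereal_scope.

(* The proofs are arguments so that the measure structure can be inferred. *)
Definition density of (forall x, 0 <= p x) & measurable_fun setT p :
  set T -> \bar R := fun A => \int[mu]_(x in A) p x.

Local Notation nu := (density p0 mp).

Let density0 : nu set0 = 0. Proof. exact: integral_set0. Qed.

Let density_ge0 A : 0 <= nu A. Proof. exact: integral_ge0. Qed.

Let density_sigma_additive : semi_sigma_additive nu.
Proof.
move=> F mF tF mUF; rewrite /density; apply: cvg_toP.
  apply: ereal_nondecreasing_is_cvgn => m n mn.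
  by apply: lee_sum_nneg_natr => // k _ _; exact: integral_ge0.
by rewrite ge0_integral_bigcup//; exact: measurable_funTS.
Qed.

HB.instance Definition _ := isMeasure.Build _ _ _ nu
  density0 density_ge0 density_sigma_additive.

End density.

Section integral_density.
Context d (T : measurableType d) (R : realType).
Variables (mu nu : {measure set T -> \bar R}) (p : T -> R).
Hypotheses (p0 : forall x, 0 <= p x) (mp : measurable_fun setT p).
Local Open Scope ereal_scope.
Hypothesis nuE : forall A, measurable A -> nu A = \int[mu]_(x in A) (p x)%:E.

Import HBNNSimple.

Let integral_density_nnsfun (g : {nnsfun T >-> R}) :
  \int[nu]_x (g x)%:E = \int[mu]_x ((g x)%:E * (p x)%:E).
Proof.
under [LHS]eq_integral do rewrite fimfunE -fsumEFin//.
rewrite [LHS]ge0_integral_fsum//; last 2 first.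
  - by move=> r; exact/measurable_EFinP/measurableT_comp.
  - by move=> n x _; rewrite EFinM nnfun_muleindic_ge0.
under [RHS]eq_integral.
  move=> x xD; rewrite fimfunE -fsumEFin// ge0_mule_fsuml; last first.
    by move=> r; rewrite EFinM nnfun_muleindic_ge0.
  over.
rewrite [RHS]ge0_integral_fsum//; last 2 first.
  - move=> r; apply: emeasurable_funM; last exact/measurable_EFinP.
    by apply/measurable_EFinP; apply/measurableT_comp.
  - move=> n x _; rewrite mule_ge0//; last by rewrite lee_fin.
    by rewrite EFinM nnfun_muleindic_ge0.
apply: eq_fsbigr => r _.
have [r0|r0] := leP 0%R r; last first.
  have gr : g @^-1` [set r] = set0.
    apply/preimage10 => -[x _ gx]; have : (0 <= g x)%R by [].
    by rewrite gx leNgt r0.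
  rewrite gr !integral0_eq// => x _; rewrite indic0 mulr0 ?mul0e//.
rewrite integralZl_indic_nnsfun// integral_indic// setIT nuE//.
under [RHS]eq_integral do rewrite EFinM -muleA.
rewrite ge0_integralZl//.
- congr (_ * _); rewrite integral_mkcond; apply: eq_integral => x _.
  by rewrite patchE indicE; case: ifP => _; rewrite ?mul1e ?mul0e.
- apply: emeasurable_funM; last exact/measurable_EFinP.
  exact/measurable_EFinP/measurable_indic.
- by move=> x _; rewrite mule_ge0// lee_fin.
Qed.

(** Simple functions first, then monotone convergence. *)
Lemma ge0_integral_density (f : T -> \bar R) :
  measurable_fun setT f -> (forall x, 0 <= f x) ->
  \int[nu]_x f x = \int[mu]_x (f x * (p x)%:E).
Proof.
move=> mf f0.
pose f_ := nnsfun_approx measurableT mf.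
have f_cvg x : (f_ n x)%:E @[n --> \oo] --> f x.
  exact: cvg_nnsfun_approx.
have nd_f_ x m n : (m <= n)%N -> (f_ m x <= f_ n x)%R.
  by move=> mn; exact/lefP/nd_nnsfun_approx.
transitivity (lim (\int[nu]_x (f_ n x)%:E @[n --> \oo])).
  rewrite -monotone_convergence//=.
  - by apply: eq_integral => x _; apply/esym/cvg_lim.
  - by move=> n; exact/measurable_EFinP/measurable_funTS.
  - by move=> n x _; rewrite lee_fin.
  - by move=> x _ m n mn; rewrite lee_fin nd_f_.
rewrite [X in limn X](_ : _ =
    (fun n => \int[mu]_x ((f_ n x)%:E * (p x)%:E))); last first.
  by apply/funext => n; exact: integral_density_nnsfun.
rewrite -monotone_convergence//=.
- apply: eq_integral => x _; apply/cvg_lim => //.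
  by apply: cvgeZr => //.
- by move=> n; apply: emeasurable_funM; apply/measurable_EFinP.
- by move=> n x _; rewrite mule_ge0 ?lee_fin.
- by move=> x _ m n mn; rewrite lee_wpmul2r ?lee_fin ?nd_f_.
Qed.

End integral_density.

Section gaussian.
Context (R : realType) (sigma : R).
Hypothesis sigma_gt0 : 0 < sigma.
Local Notation mu := (@lebesgue_measure R).

Lemma lebesgue_measure_shift (m : R) (A : set R) : measurable A ->
  mu ((fun x => x + m) @^-1` A) = mu A.
Proof.
move=> mA; have mshift : measurable_fun setT (fun x : R => x + m).
  exact: measurable_funD.
pose nu : {measure set (measurableTypeR R) -> \bar R} :=
  pushforward mu (fun x : R => x + m : measurableTypeR R).
rewrite -[LHS]/(nu mshift A); apply/esym.
apply: (@lebesgue_measure_unique R (nu mshift)) => // _ [[a b] /= _ <-].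
rewrite /nu /= /pushforward.
rewrite [X in _ = _ X](_ : _ = `]a - m, b - m]%classic); last first.
  apply/seteqP; split => x /=; rewrite !in_itv/= => /andP[? ?];
  by apply/andP; split; lra.
rewrite !lebesgue_measure_itv/= !lte_fin ltrD2r.
by case: ifP => // _; rewrite -!EFinB; congr (_%:E); ring.
Qed.

Lemma integral_lebesgue_shift (m : R) (f : R -> \bar R) :
  measurable_fun setT f -> (forall x, 0 <= f x)%E ->
  (\int[mu]_x f (x + m)%R = \int[mu]_x f x)%E.
Proof.
move=> mf f0; have mshift : measurable_fun setT (fun x : R => x + m).
  exact: measurable_funD.
pose nu : {measure set (measurableTypeR R) -> \bar R} :=
  pushforward mu (fun x : R => x + m : measurableTypeR R).
transitivity (\int[nu mshift]_x f x)%E.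
  by apply/esym; apply: (@ge0_integral_pushforward _ _ _ (measurableTypeR R)).
apply: (@eq_measure_integral _ _ _ setT mu (nu mshift)) => B mB _.
exact: lebesgue_measure_shift.
Qed.

Lemma normal_probE (m : R) (A : set R) : measurable A ->
  normal_prob m sigma A =
  (\int[mu]_x ((\1_A x)%:E * (normal_pdf m sigma x)%:E))%E.
Proof.
move=> mA; rewrite /normal_prob integral_mkcond; apply: eq_integral => x _.
by rewrite patchE indicE; case: ifP => _; rewrite ?mul1e ?mul0e.
Qed.

Lemma measurable_indic_normal_pdf (m : R) (A : set R) : measurable A ->
  measurable_fun setT (fun x => (\1_A x)%:E * (normal_pdf m sigma x)%:E)%E.
Proof.
move=> mA; apply: emeasurable_funM; apply/measurable_EFinP.
  exact: measurable_indic.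
exact: measurable_normal_pdf.
Qed.

Lemma normal_prob_shift (m : R) (A : set R) : measurable A ->
  normal_prob 0 sigma ((fun x => x + m) @^-1` A) = normal_prob m sigma A.
Proof.
move=> mA; have mshift : measurable_fun setT (fun x : R => x + m).
  exact: measurable_funD.
have mA' : measurable ((fun x : R => x + m) @^-1` A).
  by rewrite -[X in measurable X]setTI; exact: mshift.
rewrite (normal_probE 0 mA') (normal_probE m mA).
rewrite -(integral_lebesgue_shift m (measurable_indic_normal_pdf m mA)).
  apply: eq_integral => x _; rewrite !indicE; congr (_%:E * _%:E)%E.
  by rewrite !normal_pdfE ?gt_eqF// /normal_fun subr0 addrK.
by move=> x; rewrite mule_ge0 ?lee_fin ?normal_pdf_ge0.
Qed.

(** Exponential tilting: completing the square turns [expR (t * x)] times the centered density into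
    a constant times the density with mean [t * sigma ^+ 2]. Both the moment generating function and
    the likelihood ratio of a shift follow. *)
Lemma normal_tilt (t : R) (A : set R) : measurable A ->
  (\int[normal_prob 0 sigma]_x ((expR (t * x))%:E * (\1_A x)%:E) =
   (expR (t ^+ 2 * sigma ^+ 2 / 2))%:E * normal_prob (t * sigma ^+ 2) sigma A)%E.
Proof.
move=> mA.
have me : measurable_fun setT (fun x : R => expR (t * x)).
  by apply: measurableT_comp => //; exact: measurable_funM.
rewrite (ge0_integral_density (mu := mu) (p := normal_pdf 0 sigma))//.
- rewrite (normal_probE _ mA).
  apply: (@etrans _ _ (\int[mu]_x ((expR (t ^+ 2 * sigma ^+ 2 / 2))%:E *
      ((\1_A x)%:E * (normal_pdf (t * sigma ^+ 2) sigma x)%:E)))%E); last first.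
    apply: ge0_integralZl => //; first exact: measurable_indic_normal_pdf.
            by move=> x _; rewrite mule_ge0 ?lee_fin ?normal_pdf_ge0.
  apply: eq_integral => x _; rewrite -!EFinM; congr (_%:E).
  rewrite !normal_pdfE ?gt_eqF// -mulrA mulrCA [RHS]mulrCA; congr (_ * _).
  rewrite mulrCA [RHS]mulrCA; congr (_ * _); rewrite /normal_fun -!expRD.
  congr expR; rewrite subr0; field; rewrite gt_eqF//.
- by move=> x; exact: normal_pdf_ge0.
- exact: measurable_normal_pdf.
- by apply: emeasurable_funM; apply/measurable_EFinP.
Qed.

Lemma normal_mgf (t : R) :
  (\int[normal_prob 0 sigma]_x (expR (t * x))%:E =
   (expR (t ^+ 2 * sigma ^+ 2 / 2))%:E)%E.
Proof.
have := normal_tilt t (@measurableT _ R).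
by rewrite probability_setT mule1 => <-; apply: eq_integral => x _;
  rewrite indicT mule1.
Qed.

(* The likelihood ratio of [N(1, sigma^2)] with respect to [N(0, sigma^2)]. *)
Lemma normal_prob_shift1 (A : set R) : measurable A ->
  normal_prob 0 sigma ((fun x => 1 + x) @^-1` A) =
  (\int[normal_prob 0 sigma]_x
    ((expR (x / sigma ^+ 2 - 1 / (sigma ^+ 2 *+ 2)))%:E * (\1_A x)%:E))%E.
Proof.
move=> mA; rewrite (_ : (fun x => 1 + x) = (fun x => x + 1)); last first.
  by apply/funext => x; rewrite addrC.
rewrite normal_prob_shift//.
(* Tilting by [1 / sigma ^+ 2] moves the mean to exactly [1]. *)
have := normal_tilt (sigma ^+ 2)^-1 mA.
rewrite mulVf ?gt_eqF ?exprn_gt0// => H.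
set c := expR _ in H.
transitivity (((c^-1)%:E * (c%:E * normal_prob 1 sigma A))%E).
  by rewrite muleA -EFinM mulVf ?mul1e// gt_eqF ?expR_gt0.
rewrite -H -ge0_integralZl//.
- apply: eq_integral => x _; rewrite -!EFinM mulrA; congr (_ * _)%:E.
  rewrite /c -expRN -expRD; congr expR; field; rewrite gt_eqF//.
- apply: emeasurable_funM; apply/measurable_EFinP.
    by apply: measurableT_comp => //; exact: measurable_funM.
  exact: measurable_indic.
- by rewrite lee_fin invr_ge0 expR_ge0.
Qed.

End gaussian.

(** * Step functions and designs *)

Section grid_count.
Context (R : realType).
Implicit Types a b x y : R.

(** The truncation gives the empty segment, where [b < a], length [0]. *)
Definition itv_length a b : R := Num.max 0 (b - a).

(** The sum is the integer part of [y]. The induction on [n] also carries the case [n <= y], in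
    which every term is [1]. *)
Lemma sum_leS_bounds (n : nat) y : 0 <= y <= n%:R ->
  y - 1 <= \sum_(i < n) (i.+1%:R <= y)%R%:R <= y.
Proof.
move=> /andP[y0 yn].
suff [_ H] : (n%:R <= y -> \sum_(i < n) (i.+1%:R <= y)%R%:R = n%:R :> R) /\
    (y <= n%:R -> y - 1 <= \sum_(i < n) (i.+1%:R <= y)%R%:R <= y) by exact: H yn.
elim: n {yn} => [|n [IH1 IH2]].
  by rewrite big_ord0; split => // ?; apply/andP; split => //; lra.
rewrite big_ord_recr/= -natr1; have [ny|ny] := leP (n%:R + 1) y.
  rewrite mulr1n IH1; last lra.
  by split => // ?; apply/andP; split; lra.
rewrite mulr0n addr0; split => [|_]; first by move=> ?; lra.
have [yn|yn] := leP n%:R y; last exact/IH2/ltW.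
by rewrite IH1//; apply/andP; split; lra.
Qed.

(** The strict inequality counts the positive integers below [x], so that subtracting this count
    keeps a left endpoint lying on the grid. *)
Lemma sum_ltS_bounds (n : nat) x : 0 <= x <= n%:R ->
  x - 1 <= \sum_(i < n) (i.+1%:R < x)%R%:R <= x.
Proof.
move=> /andP[x0 xn].
suff [_ H] : (n%:R < x -> \sum_(i < n) (i.+1%:R < x)%R%:R = n%:R :> R) /\
    (x <= n%:R -> x - 1 <= \sum_(i < n) (i.+1%:R < x)%R%:R <= x) by exact: H xn.
elim: n {xn} => [|n [IH1 IH2]].
  by rewrite big_ord0; split => // ?; apply/andP; split => //; lra.
rewrite big_ord_recr/= -natr1; have [nx|nx] := ltP (n%:R + 1) x.
  rewrite mulr1n IH1; last lra.
  by split => // ?; apply/andP; split; lra.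
rewrite mulr0n addr0; split => [|_]; first by move=> ?; lra.
have [xn|xn] := ltP n%:R x; last exact/IH2.
by rewrite IH1//; apply/andP; split; lra.
Qed.

(** The number of grid points is a difference of two counts, each short of its target by an amount
    in [[0, 1]]; the difference is therefore off by at most [1], not [2]. *)
Lemma grid_count_bounds (n : nat) a b : (0 < n)%N -> 0 <= a -> b <= 1 ->
  `|\sum_(i < n) \1_`[a, b]%classic (i.+1%:R / n%:R) - n%:R * itv_length a b|
    <= 1.
Proof.
move=> n0 a0 b1; have nR : 0 < n%:R :> R by rewrite ltr0n.
rewrite /itv_length; have [ba|ab] := ltP b a.
  rewrite big1; last first.
    move=> i _; rewrite indicE memNset//= in_itv/= => /andP[H1 H2].
    by have := le_lt_trans (le_trans H1 H2) ba; rewrite ltxx.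
  by rewrite max_l ?mulr0 ?subr0 ?normr0// subr_le0 ltW.
have -> : \sum_(i < n) \1_`[a, b]%classic (i.+1%:R / n%:R) =
    \sum_(i < n) (i.+1%:R <= n%:R * b)%R%:R -
    \sum_(i < n) (i.+1%:R < n%:R * a)%R%:R :> R.
  rewrite -sumrB; apply: eq_bigr => i _.
  rewrite indicE; set c := i.+1%:R.
  have -> : (c / n%:R \in `[a, b]%classic) = (n%:R * a <= c <= n%:R * b).
    rewrite mem_setE /= in_itv/=.
    by rewrite ler_pdivlMr// ler_pdivrMr// ![_ * n%:R]mulrC.
  have nab : n%:R * a <= n%:R * b by rewrite ler_pM2l.
  case: (leP c (n%:R * b)) => cb; case: (ltP c (n%:R * a)) => ca.
  - by rewrite subrr.
  - by rewrite subr0.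
  - by have := lt_trans (lt_le_trans ca nab) cb; rewrite ltxx.
  - by rewrite subr0.
rewrite max_r ?subr_ge0// ler_norml.
have a1 : a <= 1 by exact: le_trans b1.
have b0 : 0 <= b by exact: le_trans ab.
have /sum_leS_bounds/andP[] : 0 <= n%:R * b <= n%:R.
  by rewrite mulr_ge0 ?ler0n//= ler_piMr ?ler0n.
have /sum_ltS_bounds/andP[] : 0 <= n%:R * a <= n%:R.
  by rewrite mulr_ge0 ?ler0n//= ler_piMr ?ler0n.
by move=> *; apply/andP; split; lra.
Qed.

End grid_count.

Section step_functions.
Context (R : realType).
Implicit Types s : seq (R * (R * R)).

(* [(c, (a, b))] stands for [c] times the indicator of [[a, b]]. *)
Definition step_fun s (x : R) : R :=
  \sum_(t <- s) t.1 * \1_`[t.2.1, t.2.2]%classic x.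

Definition step_integral s : R := \sum_(t <- s) t.1 * itv_length t.2.1 t.2.2.

(** Bounds the error of the sum over the grid, each indicator being miscounted by at most [1]. It
    depends on the list and not only on the function. *)
Definition step_norm s : R := \sum_(t <- s) `|t.1|.

Definition step_in01 s := all (fun t => (0 <= t.2.1) && (t.2.2 <= 1)) s.

Lemma measurable_step_fun s : measurable_fun setT (step_fun s).
Proof.
elim: s => [|t s IH].
  rewrite (_ : step_fun _ = cst 0)//.
  by apply/funext => x; rewrite /step_fun big_nil.
rewrite (_ : step_fun _ = 
  fun x => t.1 * \1_`[t.2.1, t.2.2]%classic x + step_fun s x).
  by apply: measurable_funD => //; apply: measurable_funM.
by apply/funext => x; rewrite /step_fun big_cons.
Qed.

Lemma sum_grid_step_fun (n : nat) s : (0 < n)%N -> step_in01 s ->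
  \sum_(i < n) step_fun s (i.+1%:R / n%:R) <=
  n%:R * step_integral s + step_norm s.
Proof.
move=> n0 /allP s01.
rewrite /step_fun exchange_big /= /step_integral /step_norm mulr_sumr -big_split/=.
rewrite !big_seq; apply: ler_sum => t /s01 /andP[a0 b1].
rewrite -mulr_sumr mulrCA -lerBlDl -mulrBr (le_trans (ler_norm _))// normrM.
by rewrite ler_piMr// grid_count_bounds.
Qed.

Lemma uniform_itv (a b : R) : 0 <= a -> b <= 1 ->
  uniform_prob (@ltr01 R) `[a, b]%classic = (itv_length a b)%:E.
Proof.
move=> a0 b1.
have [ba|ab] := ltP b a.
  rewrite set_itv_ge ?bnd_simp -?ltNge// measure0 /itv_length max_l//.
  by rewrite subr_le0 ltW.
rewrite /uniform_prob integral_uniform_pdf setIidl; last first.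
  move=> x /=; rewrite !in_itv/= => /andP[ax xb].
  by rewrite (le_trans a0)//= (le_trans xb).
rewrite (eq_integral (cst 1%:E)); last first.
  move=> x; rewrite inE/= in_itv/= => /andP[ax xb].
  by rewrite /uniform_pdf (le_trans a0)//= (le_trans xb)// subr0 invr1.
rewrite integral_cst//= mul1e lebesgue_measure_itv/= lte_fin /itv_length.
have [ab'|] := ltP a b; first by rewrite max_r ?subr_ge0 ?EFinB.
by move=> ba; rewrite max_l// subr_le0.
Qed.

Lemma integral_step_fun s : step_in01 s ->
  (uniform_prob (@ltr01 R)).-integrable setT (EFin \o step_fun s) /\
  (\int[uniform_prob (@ltr01 R)]_x (step_fun s x)%:E = (step_integral s)%:E)%E.
Proof.
elim: s => [_|t s IH /andP[/andP[a0 b1] /IH[intS intE]]].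
  rewrite (_ : EFin \o step_fun _ = cst 0%E); last first.
    by apply/funext => x /=; rewrite /step_fun big_nil.
  split; first exact: integrable0.
  rewrite /step_integral big_nil; under eq_integral do rewrite /step_fun big_nil.
  exact: integral0.
pose f := fun x : R => (t.1%:E * (\1_`[t.2.1, t.2.2]%classic x)%:E)%E.
have int1 : (uniform_prob (@ltr01 R)).-integrable setT
    (fun x => (\1_`[t.2.1, t.2.2]%classic x)%:E).
  exact: integrable_indic.
have intf : (uniform_prob (@ltr01 R)).-integrable setT f.
  exact: integrableZl.
have stepE x : ((step_fun (t :: s) x)%:E = f x + (step_fun s x)%:E)%E.
  by rewrite /step_fun big_cons EFinD.
split.
  rewrite (_ : EFin \o _ = f \+ (EFin \o step_fun s))%E; last first.
    by apply/funext => x; rewrite /= stepE.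
  exact: integrableD.
under eq_integral do rewrite stepE.
rewrite integralD//= intE /f /step_integral big_cons EFinD; congr (_ + _)%E.
rewrite integralZl//= EFinM; congr (_ * _)%E.
by rewrite integral_indic// setIT; exact: uniform_itv.
Qed.

End step_functions.

Lemma integral_probability_cst d (T : measurableType d) (R : realType)
  (P : probability T R) (c : \bar R) : (\int[P]_w c = c)%E.
Proof.
rewrite integral_cst// -[RHS]mule1; congr (_ * _)%E; exact: probability_setT.
Qed.

(** * Products over the two designs *)

Section design.
Context d (T : measurableType d) (R : realType) (P : probability T R) (n : nat).

Lemma independent2_cst d1 (T1 : measurableType d1) d2 (T2 : measurableType d2)
    (c : T1) (f : T -> T1) (g : T -> T2) : measurable_fun setT g ->
  (forall w, f w = c) -> independent2 P f g.
Proof.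
move=> mg fc A B mA mB; have [Ac|Ac] := pselect (A c).
  rewrite (_ : f @^-1` A = setT) ?setTI ?probability_setT ?mul1e//.
  by apply/seteqP; split => // w _ /=; rewrite fc.
rewrite (_ : f @^-1` A = set0) ?set0I ?measure0 ?mul0e//.
by apply/seteqP; split => // w /=; rewrite fc.
Qed.

Lemma integral_prod_iid (U : 'I_n -> {RV P >-> R}) 
    (mu : probability (measurableTypeR R) R) (f : R -> \bar R) :
  iid_with_law U mu -> measurable_fun setT f -> (forall x, 0 <= f x)%E ->
  (\int[P]_w \prod_(i < n) f (U i w) = \prod_(i < n) \int[mu]_x f x)%E.
Proof.
move=> U_mu mf f0.
(* With a constant design, the product formula for design and noise becomes the one for i.i.d.
   variables. *)
have U0 : independent2 P (joint (fun i : 'I_n => (cst 0 : {RV P >-> R})))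
    (joint U).
  apply: (independent2_cst (c := [tuple (0 : R) | i < n])).
    exact: measurable_joint.
  by move=> w; apply: eq_from_tnth => i; rewrite !tnth_mktuple.
have := integral_prod_independent U_mu U0 (phi := fun _ z => f z.2).
move=> /= ->//.
- exact: integral_probability_cst.
- by move=> _; exact: measurableT_comp.
Qed.

(** Everything rests on [1 + x <= expR x]. On the regular grid it is applied to each factor, and
    [step_norm] pays for the discretization; for uniform points it is applied to the common integral
    [1 + step_integral s]. *)
Lemma design_bound (X : 'I_n -> {RV P >-> R}) (s : seq (R * (R * R))) :
  (0 < n)%N -> deterministic_design X \/ random_design X ->
  step_in01 s -> (forall x, 0 <= 1 + step_fun s x) ->
  (\int[P]_w (\prod_(i < n) (1 + step_fun s (X i w)))%:E <=
   (expR (n%:R * step_integral s + step_norm s))%:E)%E.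
Proof.
move=> n0 design s01 h0.
have norm0 : 0 <= step_norm s by apply: sumr_ge0.
case: design => [XE|[U [U_iid XU]]].
  rewrite (eq_integral
      (cst (\prod_(i < n) (1 + step_fun s (i.+1%:R / n%:R)))%:E)); last first.
    by move=> w _; congr (_%:E); apply: eq_bigr => i _; rewrite XE.
  rewrite integral_probability_cst lee_fin.
  apply: (@le_trans _ _ (\prod_(i < n) expR (step_fun s (i.+1%:R / n%:R)))).
    by apply: ler_prod => i _; rewrite h0 expR_ge1Dx.
  by rewrite -expR_sum ler_expR sum_grid_step_fun.
have [intS intE] := integral_step_fun s01.
have mS := measurable_step_fun s.
(* The product is symmetric, so sorting the points does not change it. *)
have prodE w : \prod_(i < n) (1 + step_fun s (X i w)) =
    \prod_(i < n) (1 + step_fun s (U i w)).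
  have tupE (Z : 'I_n -> {RV P >-> R}) : \prod_(i < n) (1 + step_fun s (Z i w)) =
      \prod_(x <- joint Z w) (1 + step_fun s x).
    by rewrite big_tuple; apply: eq_bigr => i _; rewrite tnth_mktuple.
  rewrite !tupE; apply: perm_big; rewrite XU; apply/permPl; exact: perm_sort.
under eq_integral do rewrite prodE -prodEFin.
rewrite (@integral_prod_iid U (uniform_prob (@ltr01 R))
  (fun x => (1 + step_fun s x)%:E))//; last first.
  by apply/measurable_EFinP; exact: measurable_funD.
have SE : (\int[uniform_prob (@ltr01 R)]_x (1 + step_fun s x)%:E =
    (1 + step_integral s)%:E)%E.
  under eq_integral do rewrite EFinD.
  rewrite integralD//=; last exact: finite_measure_integrable_cst.
  by rewrite intE integral_probability_cst.
have S0 : 0 <= 1 + step_integral s.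
  rewrite -lee_fin -SE; apply: integral_ge0 => x _; rewrite lee_fin; exact: h0.
rewrite SE prodEFin lee_fin big_const_ord iter_mulr_1.
apply: (@le_trans _ _ (expR (step_integral s) ^+ n)).
  by rewrite lerXn2r ?nnegrE ?expR_ge0// expR_ge1Dx.
by rewrite -expRM_natl ler_expR lerDl.
Qed.

End design.

(** * Change of measure and the lower bound *)

Section change_of_measure.
Context d (T : measurableType d) (R : realType) (P : probability T R).
Context (n : nat) (X xi : 'I_n -> {RV P >-> R}) (sigma : R).
Hypothesis sigma_gt0 : 0 < sigma.
Hypothesis xi_iid : iid_with_law xi (normal_prob 0 sigma).
Hypothesis Xxi : independent2 P (joint X) (joint xi).

(** Likelihood ratio of a single observation: [N(1, sigma^2)] against [N(0, sigma^2)] if the design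
    point lies in [G], and [1] otherwise. *)
Definition likelihood (G : set R) (z : R * R) : R :=
  expR (\1_G z.1 * (z.2 / sigma ^+ 2 - 1 / (sigma ^+ 2 *+ 2))).

Definition likelihood_ratio (G : set R) (w : T) : R :=
  \prod_(i < n) likelihood G (X i w, xi i w).

Let measurable_indic_fst (G : set R) : measurable G ->
  measurable_fun setT (fun z : R * R => \1_G z.1 : R).
Proof.
by move=> mG; apply: (measurableT_comp (f := \1_G : R -> R)).
Qed.

Lemma measurable_likelihood G : measurable G ->
  measurable_fun setT (likelihood G).
Proof.
move=> mG; apply: measurableT_comp => //; apply: measurable_funM.
  exact: measurable_indic_fst.
by apply: measurable_funD => //; apply: measurable_funM.
Qed.

Lemma measurable_RV_pair i : measurable_fun setT (fun w => (X i w, xi i w)).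
Proof. by apply: measurable_fun_pair; exact: measurable_funP. Qed.

Lemma measurable_likelihood_ratio G : measurable G ->
  measurable_fun setT (likelihood_ratio G).
Proof.
move=> mG; apply: measurable_prod => i _.
exact: (measurableT_comp (measurable_likelihood mG) (measurable_RV_pair i)).
Qed.

Definition shifted (G : set R) (z : R * R) : R * R := (z.1, \1_G z.1 + z.2).

Lemma measurable_shifted G : measurable G -> measurable_fun setT (shifted G).
Proof.
move=> mG; apply: measurable_fun_pair => //; apply: measurable_funD => //.
exact: measurable_indic_fst.
Qed.

Lemma measurable_observations G : measurable G ->
  measurable_fun setT (observations X xi G).
Proof.
move=> mG; apply/measurable_fun_tnthP => i.
rewrite (_ : _ \o _ = shifted G \o (fun w => (X i w, xi i w))).
  exact: (measurableT_comp (measurable_shifted mG) (measurable_RV_pair i)).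
by apply/funext => w; rewrite /= tnth_mktuple.
Qed.

Lemma integral_likelihood G (D : set (R * R)) (x : R) :
  measurable G -> measurable D ->
  (\int[normal_prob 0 sigma]_y (\1_D (shifted G (x, y)))%:E =
   \int[normal_prob 0 sigma]_y (likelihood G (x, y) * \1_D (x, y))%:E)%E.
Proof.
move=> mG mD; rewrite /shifted /likelihood /= indicE.
have [xG|xG] := boolP (x \in G); last first.
  by apply: eq_integral => y _; rewrite mul0r expR0 mul1r add0r.
have mDx : measurable [set y | D (x, y)].
  have mx : measurable_fun setT (fun y : R => (x, y)).
    exact: measurable_fun_pair.
  by rewrite -[X in measurable X]setTI; exact: mx.
transitivity (\int[normal_prob 0 sigma]_y
    (\1_((fun y => 1 + y) @^-1` [set y | D (x, y)]) y)%:E)%E.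
  by apply: eq_integral => y _; rewrite !indicE.
rewrite integral_indic//; last first.
  have m1 : measurable_fun setT (fun y : R => 1 + y) by exact: measurable_funD.
  by rewrite -[X in measurable X]setTI; exact: m1.
rewrite setIT; apply: (etrans (normal_prob_shift1 sigma_gt0 mDx)).
apply: eq_integral => y _; rewrite EFinM !indicE; congr ((expR _)%:E * _)%E.
by rewrite [RHS]mul1r.
Qed.

(** Both sides are measures in [B], so boxes suffice. There the likelihood ratio and the indicator
    factor over the coordinates, and each factor is a Gaussian shift by [0] or [1]. Observations
    under [set0] are pure noise. *)
Lemma change_of_measure G (B : set (n.-tuple (R * R))) :
  measurable G -> measurable B ->
  (P (observations X xi G @^-1` B) =
   \int[P]_w (likelihood_ratio G w * \1_B (observations X xi set0 w))%:E)%E.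
Proof.
move=> mG mB.
have L0 w : (0 <= (likelihood_ratio G w)%:E)%E.
  by rewrite lee_fin; apply: prodr_ge0 => i _; exact: expR_ge0.
have mL : measurable_fun setT (EFin \o likelihood_ratio G).
  by apply/measurable_EFinP; exact: measurable_likelihood_ratio.
pose m1 : {measure set (n.-tuple (R * R)) -> \bar R} :=
  pushforward P (observations X xi G).
pose m2 : {measure set (n.-tuple (R * R)) -> \bar R} :=
  pushforward (density P L0 mL) (observations X xi set0).
have mo G' := @measurable_observations G'.
have m0 := mo set0 measurable0.
have mobs0 (A : set (n.-tuple (R * R))) : measurable A ->
    measurable (observations X xi set0 @^-1` A).
  by move=> mA; rewrite -[X in measurable X]setTI; exact: m0.
have m2E A : measurable A -> m2 m0 A =
    (\int[P]_w (likelihood_ratio G w * \1_A (observations X xi set0 w))%:E)%E.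
  move=> mA; rewrite /m2 /= /pushforward /density integral_mkcond.
  apply: eq_integral => w _; rewrite patchE indicE.
  rewrite (_ : (w \in _ @^-1` _) = (observations X xi set0 w \in A))//.
  by case: ifP; rewrite ?mulr1 ?mulr0.
rewrite -m2E// -[LHS]/(m1 (mo _ mG) B).
apply: (measure_unique (@boxes _ (R * R)%type n) (fun=> setT)) => //.
- exact: measurable_boxesE.
- exact: setI_closed_boxes.
- by move=> _; exact: boxes_setT.
- by apply/seteqP; split => // x _; exists 0%N.
- move=> A bA; have mA := boxes_measurable bA; rewrite m2E//.
  case: bA => D mD AE.
  have indA (z : n.-tuple (R * R)) :
      \1_A z = \prod_(i < n) \1_(D i) (tnth z i) :> R.
    have [Az|Az] := pselect (A z).
      rewrite indicE mem_set// big1// => i _; rewrite indicE mem_set//.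
      by move: Az; rewrite AE; exact.
    have [i Di] : exists i, ~ D i (tnth z i).
      by apply/existsNP; move: Az; rewrite AE.
    by rewrite indicE memNset// (bigD1 i)//= indicE memNset// mul0r.
  transitivity (\int[P]_w \prod_(i < n)
      (\1_(D i) (shifted G (X i w, xi i w)))%:E)%E.
    have mobsA : measurable (observations X xi G @^-1` A).
      by rewrite -[X in measurable X]setTI; exact: mo.
    rewrite -[LHS]/(P (observations X xi G @^-1` A)) -[X in P X]setIT.
    rewrite -integral_indic//; apply: eq_integral => w _.
    rewrite prodEFin; congr (_%:E).
    rewrite -[LHS]/(\1_A (observations X xi G w)) indA.
    by apply: eq_bigr => i _; rewrite tnth_mktuple.
  transitivity (\int[P]_w \prod_(i < n) (likelihood G (X i w, xi i w) *
      \1_(D i) (X i w, xi i w))%:E)%E; last first.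
    apply: eq_integral => w _; rewrite prodEFin big_split/=; congr (_%:E).
    congr (_ * _); rewrite indA; apply: eq_bigr => i _.
    by rewrite tnth_mktuple indic0 add0r.
  rewrite (integral_prod_independent xi_iid Xxi
    (phi := fun i z => (\1_(D i) (shifted G z))%:E)); first last.
  + by move=> j z; rewrite lee_fin.
  + move=> j; apply/measurable_EFinP.
    exact: (measurableT_comp (f := \1_(D j) : _ -> R) _ (measurable_shifted mG)).
  rewrite (integral_prod_independent xi_iid Xxi
    (phi := fun i z => (likelihood G z * \1_(D i) z)%:E)); first last.
  + by move=> j z; rewrite lee_fin mulr_ge0// expR_ge0.
  + move=> j; apply/measurable_EFinP; apply: measurable_funM => //.
    exact: measurable_likelihood.
  apply: eq_integral => w _; apply: eq_bigr => i _.
  exact: integral_likelihood.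
- move=> _; rewrite -[X in (X < _)%E]/(P (observations X xi G @^-1` setT)).
  by rewrite preimage_setT (le_lt_trans (probability_le1 _ _)) ?ltry.
Qed.

(** On [G] the square is [expR (2 y / sigma^2 - 1 / sigma^2)], whose Gaussian mean is
    [expR (1 / sigma^2)]. *)
Lemma integral_likelihood_sqr G (x : R) :
  (\int[normal_prob 0 sigma]_y (likelihood G (x, y) ^+ 2)%:E =
   (1 + (expR (sigma ^+ 2)^-1 - 1) * \1_G x)%:E)%E.
Proof.
rewrite /likelihood /=; rewrite indicE.
have [xG|xG] := boolP (x \in G); rewrite ?mulr1n ?mulr0n; last first.
  under eq_integral do rewrite mul0r expR0 expr1n.
  by rewrite mulr0 addr0; exact: integral_probability_cst.
transitivity (\int[normal_prob 0 sigma]_y ((expR (- (sigma ^+ 2)^-1))%:E *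
    (expR ((2 / sigma ^+ 2) * y))%:E))%E.
  apply: eq_integral => y _; rewrite -EFinM -expRM_natl -expRD.
  by congr (expR _)%:E; field; rewrite gt_eqF.
rewrite ge0_integralZl//.
- apply: (etrans (congr1 (mule _) (normal_mgf sigma_gt0 _))).
  rewrite mulr1 addrC subrK -EFinM -expRD.
  by congr (expR _)%:E; field; rewrite gt_eqF.
- by apply/measurable_EFinP; apply: measurableT_comp => //; exact: measurable_funM.
Qed.

(** Once the noise is integrated out, each factor is [1] plus a step function of the design point,
    so [design_bound] applies. *)
Lemma likelihood_ratio_second_moment (a b : R) :
  (0 < n)%N -> deterministic_design X \/ random_design X ->
  0 <= a -> b <= 1 ->
  (\int[P]_w (likelihood_ratio `[a, b]%classic w ^+ 2)%:E <=
   (expR ((expR (sigma ^+ 2)^-1 - 1) * (n%:R * itv_length a b + 1)))%:E)%E.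
Proof.
move=> n0 design a0 b1; set k := expR _ - 1.
have k0 : 0 <= k by rewrite subr_ge0 -expR0 ler_expR invr_ge0 sqr_ge0.
pose s := [:: (k, (a, b))].
have sE x : step_fun s x = k * \1_`[a, b]%classic x.
  by rewrite /step_fun big_seq1.
have mab : measurable (`[a, b]%classic : set R) by [].
have -> : (\int[P]_w (likelihood_ratio `[a, b]%classic w ^+ 2)%:E =
    \int[P]_w (\prod_(i < n) (1 + step_fun s (X i w)))%:E)%E.
  transitivity (\int[P]_w \prod_(i < n)
      (likelihood `[a, b]%classic (X i w, xi i w) ^+ 2)%:E)%E.
    by apply: eq_integral => w _; rewrite prodEFin -prodrXl.
  rewrite (integral_prod_independent xi_iid Xxi
    (phi := fun i z => (likelihood `[a, b]%classic z ^+ 2)%:E)); first last.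
  + by move=> j z; rewrite lee_fin sqr_ge0.
  + move=> j; apply/measurable_EFinP; apply: measurable_funX.
    exact: measurable_likelihood.
  apply: eq_integral => w _; rewrite -prodEFin; apply: eq_bigr => i _.
  by rewrite sE; exact: integral_likelihood_sqr.
apply: (le_trans (design_bound n0 design (s := s) _ _)).
- by rewrite /step_in01/= a0 b1.
- by move=> x; rewrite sE addr_ge0// mulr_ge0.
rewrite lee_fin ler_expR /step_integral /step_norm !big_seq1/= ger0_norm//.
by rewrite mulrDr mulr1 mulrCA.
Qed.

End change_of_measure.

Section endpoint_loss.
Context (R : realType).

(** The left endpoint alone forces the loss, even when [[a, b]] is empty: an interval of length
    [delta / 2] starting or ending at [l] lies in exactly one of the two segments. *)
Lemma half_length_le_symdiff (l delta a b : R) :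
  0 < delta -> delta / 2 <= `|a - l| ->
  ((delta / 2)%:E <=
   lebesgue_measure (`[l, (l + delta)%R]%classic `+` `[a, b]%classic))%E.
Proof.
move=> delta0 al.
suff [c sub] : exists c : R, `[c, c + delta / 2[%classic `<=`
    `[l, l + delta]%classic `+` `[a, b]%classic.
  apply: (@le_trans _ _ (lebesgue_measure `[c, c + delta / 2[%classic)).
    rewrite lebesgue_measure_itv/= lte_fin ltrDl divr_gt0//.
    by rewrite -EFinB addrAC subrr add0r.
  apply: le_measure => //; rewrite inE//.
  by apply: measurableU; apply: measurableD.
have [la|la] := leP l a.
  rewrite ger0_norm ?subr_ge0// in al; exists l => x /=.
  rewrite !in_itv/= => /andP[lx xd]; left; split.
    by rewrite lx/=; lra.
  by move=> /andP[ax _]; lra.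
rewrite ltr0_norm ?subr_lt0// in al.
have [lb|bl] := leP l b.
  exists (l - delta / 2) => x /=; rewrite !in_itv/= => /andP[lx xd]; right.
  split; first by apply/andP; split; lra.
  by move=> /andP[ax _]; lra.
exists l => x /=; rewrite !in_itv/= => /andP[lx xd]; left; split.
  by rewrite lx/=; lra.
by move=> /andP[_ xb]; lra.
Qed.

End endpoint_loss.

(** * Many separated segments against one estimator *)

Section lower_bound.
Context d (T : measurableType d) (R : realType) (P : probability T R).
Context (n : nat) (X xi : 'I_n -> {RV P >-> R}) (sigma : R).
Hypothesis sigma_gt0 : 0 < sigma.
Hypothesis xi_iid : iid_with_law xi (normal_prob 0 sigma).
Hypothesis Xxi : independent2 P (joint X) (joint xi).
Hypothesis n_gt0 : (0 < n)%N.
Hypothesis design : deterministic_design X \/ random_design X.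

(** On [B] the likelihood ratio [L] is at most [t + L ^ 2 / t]. The free parameter [t] balances the
    probability under pure noise against the second moment. *)
Lemma probability_observations_le (G : set R) (B : set (n.-tuple (R * R)))
    (t : R) : measurable G -> measurable B -> 0 < t ->
  (P (observations X xi G @^-1` B) <=
   t%:E * P (observations X xi set0 @^-1` B) +
   t^-1%:E * \int[P]_w (likelihood_ratio X xi sigma G w ^+ 2)%:E)%E.
Proof.
move=> mG mB t0; rewrite (change_of_measure sigma_gt0 xi_iid Xxi)//.
set L := likelihood_ratio X xi sigma G; set obs0 := observations X xi set0.
have mL : measurable_fun setT L by exact: measurable_likelihood_ratio.
have L0 w : 0 <= L w by apply: prodr_ge0 => i _; exact: expR_ge0.
have mobsB : measurable (obs0 @^-1` B).
  by rewrite -[X in measurable X]setTI; exact: measurable_observations.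
apply: (@le_trans _ _
    (\int[P]_w (t%:E * (\1_(obs0 @^-1` B) w)%:E + t^-1%:E * (L w ^+ 2)%:E))%E).
  apply: ge0_le_integralT => w; first by rewrite lee_fin mulr_ge0.
  rewrite -!EFinM -EFinD lee_fin.
  rewrite -[\1_(_ @^-1` _) w]/(\1_B (obs0 w)) indicE.
  case: (_ \in _); rewrite ?mulr1 ?mulr0 ?add0r; last first.
    by rewrite mulr_ge0 ?invr_ge0 ?sqr_ge0 ?ltW.
  (* AM-GM *)
  have : 0 <= t^-1 * (L w - t) ^+ 2 by rewrite mulr_ge0 ?invr_ge0 ?sqr_ge0 ?ltW.
  rewrite (_ : _ * _ = t + t^-1 * L w ^+ 2 - 2 * L w); last first.
    by field; rewrite gt_eqF.
  by move: (L0 w); lra.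
rewrite ge0_integralD//; first last.
- by apply: emeasurable_funM => //; apply/measurable_EFinP; exact: measurable_funX.
- by move=> w _; rewrite -EFinM lee_fin mulr_ge0 ?invr_ge0 ?sqr_ge0 ?ltW.
- by apply: emeasurable_funM => //; apply/measurable_EFinP.
- by move=> w _; rewrite -EFinM lee_fin mulr_ge0// ltW.
rewrite ge0_integralZl//; first last.
- by rewrite lee_fin ltW.
- exact/measurable_EFinP.
rewrite integral_indic// setIT ge0_integralZl//.
- by apply/measurable_EFinP; exact: measurable_funX.
- by move=> w _; rewrite lee_fin sqr_ge0.
- by rewrite lee_fin invr_ge0 ltW.
Qed.

Lemma minimax_risk_ge (M : nat) (delta : R) :
  (0 < M)%N -> 0 < delta -> M%:R * delta <= 1 ->
  16 * expR ((expR (sigma ^+ 2)^-1 - 1) * (n%:R * delta + 1)) <= M%:R ->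
  ((delta / 4)%:E <= minimax_risk X xi segments)%E.
Proof.
move=> M0 delta0 Mdelta.
set B := expR _ => MB.
apply: le_ereal_inf_tmp => _ [Ghat [[a [b [ma mb GhatE]]] _] <-].
pose l k : R := k%:R * delta.
pose G k : set R := `[l k, l k + delta]%classic.
have mG k : measurable (G k) by exact: measurable_itv.
have MR : 0 < M%:R :> R by rewrite ltr0n.
have lkM k : (k < M)%N -> l k + delta <= 1.
  move=> kM; apply: le_trans Mdelta.
  by rewrite /l -[X in _ + X]mul1r -mulrDl natr1 ler_pM2r// ler_nat.
pose A k : set (n.-tuple (R * R)) := [set z | `|a z - l k| < delta / 2].
have mA k : measurable (A k).
  have mak : measurable_fun setT (fun z => `|a z - l k|).
    by apply: measurableT_comp => //; exact: measurable_funB.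
  rewrite -[X in measurable X]setTI.
  rewrite (_ : A k = (fun z => `|a z - l k|) @^-1` `]-oo, delta / 2[%classic).
    exact: mak.
  by apply/seteqP; split => z /=; rewrite in_itv.
have mobs k (C : set _) : measurable C ->
    measurable (observations X xi (G k) @^-1` C).
  move=> mC; rewrite -[X in measurable X]setTI; exact: measurable_observations.
have mobs0 (C : set _) : measurable C ->
    measurable (observations X xi set0 @^-1` C).
  move=> mC; rewrite -[X in measurable X]setTI; exact: measurable_observations.
pose q k := fine (P (observations X xi (G k) @^-1` A k)).
have qE k : P (observations X xi (G k) @^-1` A k) = (q k)%:E.
  by rewrite fineK// fin_num_measure//; exact: mobs.
pose q0 k := fine (P (observations X xi set0 @^-1` A k)).
have q0E k : P (observations X xi set0 @^-1` A k) = (q0 k)%:E.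
  by rewrite fineK// fin_num_measure//; exact: mobs0.
(* The points [l k] are at least [delta] apart, so the left endpoint of the estimator is at distance
   less than [delta / 2] from at most one of them. *)
have sum_q0 : \sum_(k < M) q0 k <= 1.
  rewrite -lee_fin -sumEFin; under eq_bigr do rewrite -q0E.
  rewrite -(@measure_bigsetU_ord _ _ _ P M predT
    (fun k : 'I_M => observations X xi set0 @^-1` A k)).
  - apply: probability_le1; apply: bigsetU_measurable => k _.
    exact: mobs0.
  - by move=> k; exact: mobs0.
  - move=> i j _ _ [w [/= Ai Aj]]; apply/val_inj => /=.
    have lS (u v : 'I_M) : (u < v)%N -> A u (observations X xi set0 w) ->
        A v (observations X xi set0 w) -> False.
      move=> uv; rewrite /A /= !ltr_norml => /andP[_ Au] /andP[Av _].
      have : (u.+1%:R * delta <= v%:R * delta)%R by rewrite ler_pM2r// ler_nat.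
      by rewrite -natr1 mulrDl mul1r; move: Au Av; rewrite /l; lra.
    case: (ltngtP i j) => // ij; exfalso; first exact: lS ij Ai Aj.
    exact: lS ij Aj Ai.
(* The choice [t = M / 4] makes the first terms add up to at most [M / 4] and the second ones to
   [4 * B], which is also at most [M / 4]. *)
have q_le (k : 'I_M) : q k <= M%:R / 4 * q0 k + 4 / M%:R * B.
  have t0 : 0 < M%:R / 4 :> R by rewrite divr_gt0.
  have := probability_observations_le (mG k) (mA k) t0.
  have lk0 : 0 <= l k by rewrite mulr_ge0// ltW.
  have len : itv_length (l k) (l k + delta) = delta.
    by rewrite /itv_length addrAC subrr add0r max_r// ltW.
  have := likelihood_ratio_second_moment sigma_gt0 xi_iid Xxi n_gt0 design
    lk0 (lkM k (ltn_ord k)).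
  rewrite -/(G k) len -/B qE q0E => LB /le_trans H.
  rewrite -lee_fin EFinD; apply: H.
  rewrite (EFinM (M%:R / 4)) leeD2l// invf_div (EFinM (4 / M%:R)).
  by rewrite lee_pmul2l// lte_fin divr_gt0.
(* The [q k] add up to at most [M / 2], so they cannot all exceed [1 / 2]. *)
have [k qk] : exists k : 'I_M, q k <= 2^-1.
  apply: contrapT => /forallNP qgt.
  have : \sum_(k < M) (2^-1 : R) < \sum_(k < M) q k.
    apply: ltr_sum; last by move=> k _; rewrite ltNge; apply/negP/qgt.
    by apply/hasP; exists (Ordinal M0) => //; rewrite mem_index_enum.
  have : \sum_(k < M) q k <=
      \sum_(k < M) (M%:R / 4 * q0 k + 4 / M%:R * B).
    by apply: ler_sum => k _; exact: q_le.
  have sum_cst (c : R) : \sum_(k < M) c = M%:R * c.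
    by rewrite sumr_const card_ord mulr_natl.
  rewrite big_split/= -mulr_sumr !sum_cst mulrA mulrCA mulfV ?gt_eqF// mulr1.
  have : M%:R / 4 * \sum_(k < M) q0 k <= M%:R / 4 by rewrite ler_piMr// divr_ge0.
  move: MB; clearbody B; move: (\sum_(k < M) q0 k) (\sum_(k < M) q k) => u v.
  by lra.
apply: (@le_trans _ _ (expected_loss X xi Ghat (G k))); last first.
  apply: ereal_sup_ubound; exists (G k) => //.
  exists (l k), (l k + delta); split => //.
  - by rewrite mulr_ge0// ltW.
  - by rewrite lerDl ltW.
  - exact: lkM.
(* Loss at least [delta / 2] on an event of probability at least [1 / 2]. *)
apply: (@le_trans _ _ (\int[P]_w ((delta / 2)%:E *
    (\1_(observations X xi (G k) @^-1` ~` A k) w)%:E))%E).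
  have mC : measurable (observations X xi (G k) @^-1` ~` A k).
    by apply: mobs; exact: measurableC.
  rewrite ge0_integralZl//; last 2 first.
  - exact/measurable_EFinP.
  - by rewrite lee_fin divr_ge0// ltW.
  rewrite integral_indic// setIT preimage_setC.
  have PC := probability_setC P (mobs k _ (mA k)).
  rewrite [X in (_ <= _ * X)%E]PC qE -EFinB -EFinM lee_fin.
  have : 0 <= delta * (2^-1 - q k) by rewrite mulr_ge0 ?subr_ge0// ltW.
  by lra.
apply: ge0_le_integralT => w; first by rewrite mule_ge0// lee_fin divr_ge0// ltW.
rewrite -[\1_(_ @^-1` _) w]/(\1_(~` A k) (observations X xi (G k) w)) indicE.
have [/[!inE] Ak|_] := boolP (_ \in _); last by rewrite mule0.
rewrite mule1 GhatE; apply: half_length_le_symdiff => //.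
by rewrite leNgt; apply/negP.
Qed.

End lower_bound.

(** * The upper bound *)

Section symdiff_length.
Context (R : realType).
Implicit Types a b c d : R.

Lemma lebesgue_itv_length a b :
  lebesgue_measure (`[a, b]%classic : set R) = (itv_length a b)%:E.
Proof.
rewrite lebesgue_measure_itv/= lte_fin /itv_length.
have [ab|ba] := ltP a b; first by rewrite max_r ?EFinB// subr_ge0 ltW.
by rewrite max_l// subr_le0.
Qed.

Lemma setI_itv_cc a b c d : `[a, b]%classic `&` `[c, d]%classic =
  `[Num.max a c, Num.min b d]%classic :> set R.
Proof.
apply/seteqP; split => x /=; rewrite !in_itv/= ge_max le_min.
  by move=> [/andP[-> ->] /andP[-> ->]].
by move=> /andP[/andP[-> ->] /andP[-> ->]].
Qed.

(** Length of the symmetric difference of [[a, b]] and [[c, d]], by inclusion-exclusion. *)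
Definition itv_dist a b c d : R := itv_length a b + itv_length c d -
  2 * itv_length (Num.max a c) (Num.min b d).

Lemma lebesgue_symdiff a b c d :
  lebesgue_measure (`[a, b]%classic `+` `[c, d]%classic : set R) =
  (itv_dist a b c d)%:E.
Proof.
rewrite /setY measureU//; first last.
- by apply/seteqP; split => // x [[_ ?] []].
- by apply: measurableD.
- by apply: measurableD.
have setDE (u v x y : R) :
    lebesgue_measure (`[u, v]%classic `\` `[x, y]%classic : set R) =
    (itv_length u v - itv_length (Num.max u x) (Num.min v y))%:E.
  have fin_uv : (lebesgue_measure (`[u, v]%classic : set R) < +oo)%E.
    by rewrite lebesgue_itv_length ltry.
  by rewrite measureD// setI_itv_cc EFinB -!lebesgue_itv_length.
apply: (etrans (congr2 (@adde _) (setDE a b c d) (setDE c d a b))).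
by rewrite /= /itv_dist (maxC c) (minC d); congr (_%:E); ring.
Qed.

End symdiff_length.

(** * Measurable selection of a maximizer *)

Section argmax_seq.
Context (R : realType) (I : eqType) d (Z : measurableType d).
Variables (S : I -> Z -> R) (i0 : I).

(** The default [i0] competes with the members of [s]. The fold makes the selection a nest of
    conditionals, suited to induction. *)
Definition argmax_seq (s : seq I) (z : Z) : I :=
  foldr (fun q acc => if S acc z < S q z then q else acc) i0 s.

Lemma argmax_seq_ge (s : seq I) (z : Z) (q : I) :
  q \in s -> S q z <= S (argmax_seq s z) z.
Proof.
elim: s => // p s IH; rewrite inE /= => /predU1P[->|/IH qs].
  by case: ifPn => //; rewrite -leNgt.
by case: ifPn => // /ltW; exact: le_trans.
Qed.

(** Stated for every [h], so that the induction hypothesis covers both the conclusion and, with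
    [h := S], the comparison with the current maximum. *)
Lemma measurable_argmax_seq (s : seq I) (h : I -> Z -> R) :
  (forall q, measurable_fun setT (S q)) ->
  (forall q, measurable_fun setT (h q)) ->
  measurable_fun setT (fun z => h (argmax_seq s z) z).
Proof.
move=> mS; elim: s h => [|p s IH] h mh //=.
have -> : (fun z => h (if S (argmax_seq s z) z < S p z then p
    else argmax_seq s z) z) =
  (fun z => if S (argmax_seq s z) z < S p z then h p z
    else h (argmax_seq s z) z).
  by apply/funext => z; case: ifP.
apply: measurable_fun_ifT => //; last exact: IH.
by apply: measurable_fun_ltr => //; exact: IH.
Qed.

End argmax_seq.

Section score.
Context d (T : measurableType d) (R : realType) (P : probability T R).
Context (n : nat) (X xi : 'I_n -> {RV P >-> R}) (sigma : R).
Hypothesis sigma_gt0 : 0 < sigma.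
Hypothesis xi_iid : iid_with_law xi (normal_prob 0 sigma).
Hypothesis Xxi : independent2 P (joint X) (joint xi).
Hypothesis n_gt0 : (0 < n)%N.
Hypothesis design : deterministic_design X \/ random_design X.

(** The Gaussian log-likelihood of [K], up to a positive factor and a term free of [K]: maximizing
    it is least squares. *)
Definition score (K : set R) (z : n.-tuple (R * R)) : R :=
  \sum_(i < n) \1_K (tnth z i).1 * (2 * (tnth z i).2 - 1).

Lemma measurable_score K : measurable K -> measurable_fun setT (score K).
Proof.
move=> mK; apply: measurable_sum => i; apply: measurable_funM.
  apply: (measurableT_comp (f := \1_K : R -> R)) => //.
  exact: (measurableT_comp measurable_fst (measurable_tnth i)).
apply: measurable_funB => //; apply: measurable_funM => //.
exact: (measurableT_comp measurable_snd (measurable_tnth i)).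
Qed.

(** Where [K] and [G'] differ, the exponential moment of a score increment is [expR (- (lam / 2))],
    or [rho] at points of [G] outside [G'] that [K] contains. *)
Local Notation lam := ((4 * sigma ^+ 2)^-1).
Local Notation kappa := (1 - expR (- (lam / 2))).
Local Notation rho := (expR (3 * lam / 2)).

Lemma integral_score_increment (u g : R) :
  (\int[normal_prob 0 sigma]_y (expR (lam * (u * (2 * (g + y) - 1))))%:E =
   (expR (lam * u * (2 * g - 1) + lam * u ^+ 2 / 2))%:E)%E.
Proof.
transitivity (\int[normal_prob 0 sigma]_y
    ((expR (lam * u * (2 * g - 1)))%:E * (expR (2 * lam * u * y))%:E))%E.
  apply: eq_integral => y _; rewrite -EFinM -expRD.
  by congr (expR _)%:E; ring.
rewrite ge0_integralZl//.
- apply: (etrans (congr1 (mule _) (normal_mgf sigma_gt0 _))).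
  by rewrite -EFinM -expRD; congr (expR _)%:E; field; rewrite gt_eqF.
- by apply/measurable_EFinP; apply: measurableT_comp => //; exact: measurable_funM.
Qed.

(** A Chernoff bound for preferring [K] to the inner approximation [G'] of [G], which may be empty.
    The additive constant is the [step_norm] of the step function involved. *)
Lemma score_mgf (a b a' b' c c' : R) :
  0 <= a -> a <= a' -> b' <= b -> b <= 1 -> 0 <= a' -> b' <= 1 ->
  0 <= c -> c' <= 1 ->
  (\int[P]_w (expR (lam * (score `[c, c']%classic
        (observations X xi `[a, b]%classic w) -
      score `[a', b']%classic (observations X xi `[a, b]%classic w))))%:E <=
   (expR (n%:R * (- kappa * itv_dist c c' a' b' +
       rho * (itv_length a b - itv_length a' b')) + 4 * kappa + 2 * rho))%:E)%E.
Proof.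
move=> a0 aa' bb' b1 a'0 b'1 c0 c'1.
set G := `[a, b]%classic; set G' := `[a', b']%classic; set K := `[c, c']%classic.
pose phi (z : R * R) : R :=
  expR (lam * ((\1_K z.1 - \1_G' z.1) * (2 * (\1_G z.1 + z.2) - 1))).
have lam0 : 0 < lam by rewrite invr_gt0 mulr_gt0// exprn_gt0.
have kappa0 : 0 <= kappa.
  by rewrite subr_ge0 -[leRHS]expR0 ler_expR oppr_le0 divr_ge0// ltW.
(* This encodes [- kappa] on the symmetric difference of [K] and [G'], plus [rho] on [G] minus [G'];
   the intersection of two segments is again a segment. *)
pose s := [:: (- kappa, (c, c')); (- kappa, (a', b'));
  (2 * kappa, (Num.max c a', Num.min c' b')); (rho, (a, b)); (- rho, (a', b'))].
have sE x : step_fun s x = - kappa * (\1_K x + \1_G' x - 2 * (\1_K x * \1_G' x))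
    + rho * (\1_G x - \1_G' x).
  rewrite /step_fun !big_cons big_nil/= -setI_itv_cc indicI/=.
  by rewrite -/G -/G' -/K; ring.
have GG' : G' `<=` G.
  move=> x; rewrite /G /G' /= !in_itv/= => /andP[ax xb].
  by rewrite (le_trans aa')//= (le_trans xb).
(* With this [lam] the Gaussian term [2 lam^2 sigma^2] is [lam / 2]: a point of
   the symmetric difference of [K] and [G'] contributes a factor at most
   [expR (- lam / 2)], unless it lies in [G] outside [G']. *)
have incr x : expR (lam * (\1_K x - \1_G' x) * (2 * \1_G x - 1) +
    lam * (\1_K x - \1_G' x) ^+ 2 / 2) <= 1 + step_fun s x.
  rewrite sE !indicE; move: lam => l.
  have e1 : 0 <= expR (- (l / 2)) by exact: expR_ge0.
  have e2 : 0 <= expR (3 * l / 2) by exact: expR_ge0.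
  have [xG'|xG'] := boolP (x \in G').
    have -> : x \in G by rewrite inE; apply: GG'; rewrite inE in xG'.
    case: (x \in K) => /=.
      rewrite subrr mulr0 mul0r expr0n/= mulr0 mul0r addr0 expR0.
      by lra.
    rewrite (_ : _ + _ = - (l / 2)); last by field.
    by lra.
  case: (x \in K); case: (x \in G) => /=.
  - rewrite (_ : _ + _ = 3 * l / 2); last by field.
    by lra.
  - rewrite (_ : _ + _ = - (l / 2)); last by field.
    by lra.
  - rewrite subrr mulr0 mul0r expr0n/= mulr0 mul0r addr0 expR0.
    by lra.
  - rewrite subrr mulr0 mul0r expr0n/= mulr0 mul0r addr0 expR0.
    by lra.
have -> : (\int[P]_w (expR (lam * (score K (observations X xi G w) -
      score G' (observations X xi G w))))%:E =
    \int[P]_w \prod_(i < n) (phi (X i w, xi i w))%:E)%E.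
  apply: eq_integral => w _; rewrite prodEFin -expR_sum; congr (expR _)%:E.
  rewrite -sumrB mulr_sumr; apply: eq_bigr => i _.
  by rewrite !tnth_mktuple/= mulrBl.
rewrite (integral_prod_independent xi_iid Xxi
  (phi := fun i z => (phi z)%:E)); first last.
- by move=> _ z; rewrite lee_fin expR_ge0.
- move=> _; apply/measurable_EFinP; apply: measurableT_comp => //.
  have mind (A : set R) : measurable A ->
      measurable_fun setT (fun z : R * R => \1_A z.1 : R).
    by move=> mA; apply: (measurableT_comp (f := \1_A : R -> R)).
  apply: measurable_funM => //; apply: measurable_funM.
    by apply: measurable_funB; apply: mind; exact: measurable_itv.
  apply: measurable_funB => //; apply: measurable_funM => //.
  by apply: measurable_funD => //; apply: mind; exact: measurable_itv.
apply: (@le_trans _ _ (\int[P]_w (\prod_(i < n) (1 + step_fun s (X i w)))%:E)%E).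
  apply: ge0_le_integralT => w.
    by apply: prode_ge0 => i _; apply: integral_ge0 => y _;
      rewrite lee_fin expR_ge0.
  rewrite (eq_bigr (fun i => (expR (lam * (\1_K (X i w) - \1_G' (X i w)) *
      (2 * \1_G (X i w) - 1) +
    lam * (\1_K (X i w) - \1_G' (X i w)) ^+ 2 / 2))%:E)); last first.
    move=> i _; rewrite /phi /=.
    exact: (integral_score_increment (\1_K (X i w) - \1_G' (X i w))
      (\1_G (X i w))).
  rewrite prodEFin lee_fin; apply: ler_prod => i _.
  by rewrite expR_ge0 incr.
apply: (le_trans (design_bound n_gt0 design (s := s) _ _)).
- by rewrite /step_in01/= a0 b1 c0 c'1 a'0 b'1 le_max c0 ge_min c'1.
- by move=> x; apply: le_trans (incr x); exact: expR_ge0.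
rewrite lee_fin ler_expR /step_integral /step_norm !big_cons !big_nil/=.
have rho0 : 0 <= rho by exact: expR_ge0.
rewrite !normrN !ger0_norm// ?mulr_ge0// /itv_dist.
by rewrite le_eqVlt; apply/orP; left; apply/eqP; ring.
Qed.

End score.

(** * Rounding endpoints to the grid *)

Section grid_approximation.
Context (R : realType) (n : nat).
Hypothesis n_gt0 : (0 < n)%N.

Lemma grid_floor (x : R) : 0 <= x <= 1 ->
  exists q : 'I_n.+1, (q%:R / n%:R <= x <= q%:R / n%:R + n%:R^-1).
Proof.
move=> /andP[x0 x1]; have nR : 0 < n%:R :> R by rewrite ltr0n.
have /truncn_itv/andP[] : 0 <= x * n%:R by rewrite mulr_ge0.
set t := Num.truncn _ => tx xt.
have tn : (t < n.+1)%N.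
  by rewrite ltnS -(ler_nat R) (le_trans tx)// ler_piMl.
exists (Ordinal tn) => /=; rewrite ler_pdivrMr// tx/=.
by rewrite -[X in _ + X]mul1r -mulrDl natr1 ler_pdivlMr// ltW.
Qed.

(** Obtained from [grid_floor] by the reflection [x |-> 1 - x]. *)
Lemma grid_ceil (x : R) : 0 <= x <= 1 ->
  exists p : 'I_n.+1, (p%:R / n%:R - n%:R^-1 <= x <= p%:R / n%:R).
Proof.
move=> /andP[x0 x1]; have nR : 0 < n%:R :> R by rewrite ltr0n.
have [|q /andP[qx xq]] := @grid_floor (1 - x); first by apply/andP; split; lra.
exists (rev_ord q).
have -> : (rev_ord q)%:R / n%:R = 1 - q%:R / n%:R :> R.
  by rewrite /= subSS natrB -1?ltnS// mulrBl mulfV// gt_eqF.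
by apply/andP; split; lra.
Qed.

End grid_approximation.

Section itv_length_theory.
Context (R : realType).
Implicit Types a b c : R.

Lemma le_itv_length a b a' b' : a <= a' -> b' <= b ->
  itv_length a' b' <= itv_length a b.
Proof.
by move=> aa' bb'; rewrite /itv_length ge_max !le_max lexx/= lerB ?orbT.
Qed.

Lemma itv_length_approx a b a' b' e : 0 <= e -> a' - e <= a -> b <= b' + e ->
  itv_length a b <= itv_length a' b' + 2 * e.
Proof.
move=> e0 aa' bb'; rewrite /itv_length ge_max; apply/andP; split.
  by rewrite addr_ge0 ?mulr_ge0// le_max lexx.
have : b' - a' <= Num.max 0 (b' - a') by rewrite le_max lexx orbT.
by lra.
Qed.

(** Since [[a', b']] is inside [[a, b]], their distance is a difference of lengths, and the claim
    reduces to comparing intersections with [[c, c']]. *)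
Lemma itv_dist_triangle a b a' b' c c' : a <= a' -> b' <= b ->
  itv_dist a b c c' <= itv_dist c c' a' b' + (itv_length a b - itv_length a' b').
Proof.
move=> aa' bb'; rewrite /itv_dist.
have : itv_length (Num.max c a') (Num.min c' b') <=
    itv_length (Num.max a c) (Num.min b c').
  apply: le_itv_length; first by rewrite maxC ge_max !le_max aa' lexx/= orbT.
  by rewrite minC le_min !ge_min bb' lexx/= orbT.
by lra.
Qed.

End itv_length_theory.

Section upper_bound.
Context d (T : measurableType d) (R : realType) (P : probability T R).
Context (n : nat) (X xi : 'I_n -> {RV P >-> R}) (sigma : R).
Hypothesis sigma_gt0 : 0 < sigma.
Hypothesis xi_iid : iid_with_law xi (normal_prob 0 sigma).
Hypothesis Xxi : independent2 P (joint X) (joint xi).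
Hypothesis n_gt0 : (0 < n)%N.
Hypothesis design : deterministic_design X \/ random_design X.

Local Notation lam := ((4 * sigma ^+ 2)^-1).
Local Notation kappa := (1 - expR (- (lam / 2))).
Local Notation rho := (expR (3 * lam / 2)).

(** Pairs of indices in decreasing order encode the empty segment. *)
Let cand : finType := ('I_n.+1 * 'I_n.+1)%type.
Let lo (q : cand) : R := q.1%:R / n%:R.
Let hi (q : cand) : R := q.2%:R / n%:R.
Let S (q : cand) (z : n.-tuple (R * R)) : R := score `[lo q, hi q]%classic z.
Let best z := argmax_seq S (ord0, ord0) (enum cand) z.

Definition grid_estimator (z : n.-tuple (R * R)) : set R :=
  `[lo (best z), hi (best z)]%classic.

Let grid01 (i : 'I_n.+1) : 0 <= (i%:R / n%:R : R) <= 1.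
Proof.
rewrite divr_ge0//= ler_pdivrMr ?ltr0n// mul1r ler_nat -ltnS.
exact: ltn_ord.
Qed.

Let mS q : measurable_fun setT (S q).
Proof. by apply: measurable_score; exact: measurable_itv. Qed.

Lemma grid_estimatorP : estimator grid_estimator.
Proof.
split.
  exists (fun z => lo (best z)), (fun z => hi (best z)); split => //.
  - exact: (@measurable_argmax_seq _ _ _ _ S _ _ (fun q _ => lo q)).
  - exact: (@measurable_argmax_seq _ _ _ _ S _ _ (fun q _ => hi q)).
move=> z x; rewrite /grid_estimator /= !in_itv/= => /andP[lx xh].
have /andP[l0 _] := grid01 (best z).1; have /andP[_ h1] := grid01 (best z).2.
by rewrite (le_trans l0 lx) (le_trans xh h1).
Qed.

(** The three terms are the cost of rounding [G] to the grid, a free threshold [r], and the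
    exponential moment beyond [r], summed over the [(n + 1) ^ 2] candidates. *)
Lemma expected_loss_grid_estimator (a b r : R) : 0 <= a -> a <= b -> b <= 1 ->
  0 <= r ->
  (expected_loss X xi grid_estimator `[a, b]%classic <=
   (2 / n%:R + r + (kappa * n%:R)^-1 * expR (- (kappa * n%:R * r)) *
      (n.+1%:R ^+ 2 * expR (4 * kappa + 4 * rho)))%:E)%E.
Proof.
move=> a0 ab b1 r0; have nR : 0 < n%:R :> R by rewrite ltr0n.
have lam0 : 0 < lam by rewrite invr_gt0 mulr_gt0// exprn_gt0.
have kappa0 : 0 < kappa.
  by rewrite subr_gt0 -[ltRHS]expR0 ltr_expR oppr_lt0 divr_gt0.
have a01 : 0 <= a <= 1 by rewrite a0 (le_trans ab).
have b01 : 0 <= b <= 1 by rewrite b1 (le_trans a0).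
have [p /andP[pa ap]] := grid_ceil n_gt0 a01.
have [q /andP[qb bq]] := grid_floor n_gt0 b01.
(* Left endpoint rounded up, right endpoint rounded down: the result lies inside [G]. *)
pose m0 : cand := (p, q).
set G := `[a, b]%classic.
pose dist (k : cand) : R := itv_dist (lo k) (hi k) (lo m0) (hi m0).
have lengthG : itv_length a b - itv_length (lo m0) (hi m0) <= 2 / n%:R.
  by rewrite lerBlDl; apply: itv_length_approx.
pose obs := observations X xi G.
have mobs : measurable_fun setT obs.
  by apply: measurable_observations; exact: measurable_itv.
pose f (k : cand) w : R := expR (lam * (S k (obs w) - S m0 (obs w))).
have mf k : measurable_fun setT (f k).
  apply: measurableT_comp => //; apply: measurable_funM => //.
  by apply: measurable_funB; exact: (measurableT_comp (mS _) mobs).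
have f_bound k : (\int[P]_w (f k w)%:E <=
    (expR (- (kappa * n%:R * dist k)) * expR (4 * kappa + 4 * rho))%:E)%E.
  have /andP[k10 _] := grid01 k.1; have /andP[_ k21] := grid01 k.2.
  have /andP[p0 _] := grid01 p; have /andP[_ q1] := grid01 q.
  apply: (le_trans (score_mgf sigma_gt0 xi_iid Xxi n_gt0 design
    a0 ap qb b1 p0 q1 k10 k21)).
  rewrite lee_fin -expRD ler_expR -/(dist k).
  (* Rounding removes a length of at most [2 / n], which raises the constant from [2 * rho] to
     [4 * rho]. *)
  have : n%:R * (rho * (itv_length a b - itv_length (lo m0) (hi m0))) <= 2 * rho.
    rewrite mulrCA [leRHS]mulrC ler_pM2l ?expR_gt0// mulrC -ler_pdivlMr//.
  rewrite /lo /hi /=; move: kappa rho (itv_length a b) => k0 r1 L; lra.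
pose c1 := 2 / n%:R + r.
pose c2 := (kappa * n%:R)^-1 * expR (- (kappa * n%:R * r)).
have kn0 : 0 < kappa * n%:R by rewrite mulr_gt0.
have c10 : 0 <= c1 by rewrite addr_ge0// divr_ge0.
have c20 : 0 <= c2 by rewrite mulr_ge0 ?expR_ge0// invr_ge0 ltW.
have loss_le w : (lebesgue_measure (G `+` grid_estimator (obs w)) <=
    (c1 + c2 * \sum_(k : cand) expR (kappa * n%:R * dist k) * f k w)%:E)%E.
  rewrite /G /grid_estimator; set k := best (obs w).
  rewrite [X in (X <= _)%E]lebesgue_symdiff lee_fin.
  have H1 : itv_dist a b (lo k) (hi k) <= dist k + 2 / n%:R.
    apply: (le_trans (itv_dist_triangle (lo k) (hi k) ap qb)).
    by rewrite lerD2l.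
  (* [y <= expR y] turns the exponential moment into a bound on the mean. *)
  have H2 : dist k <= r + (kappa * n%:R)^-1 * expR (kappa * n%:R * (dist k - r)).
    rewrite -lerBlDl -ler_pdivrMl ?invr_gt0// invrK.
    by apply: le_trans (expR_ge1Dx _); rewrite lerDr.
  (* The maximizer depends on the data, hence the sum over all candidates. Its own factor [f k w] is
     at least [1], since its score is at least that of [m0]. *)
  have H3 : expR (kappa * n%:R * dist k) <=
      \sum_(k' : cand) expR (kappa * n%:R * dist k') * f k' w.
    rewrite (bigD1 k)//= -[leLHS]addr0 lerD//; last first.
      by apply: sumr_ge0 => k' _; rewrite mulr_ge0 ?expR_ge0.
    rewrite ler_peMr ?expR_ge0// -[leLHS]expR0 ler_expR mulr_ge0 ?(ltW lam0)//.
    rewrite subr_ge0; apply: argmax_seq_ge; exact: mem_enum.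
  apply: (le_trans H1); rewrite /c1 addrC -addrA lerD2l (le_trans H2)// lerD2l.
  rewrite mulrBr expRD mulrCA mulrC /c2 ler_wpM2l//.
rewrite /expected_loss.
apply: (@le_trans _ _ (\int[P]_w (c1%:E + c2%:E *
    \sum_(k : cand) (expR (kappa * n%:R * dist k))%:E * (f k w)%:E))%E).
  apply: ge0_le_integralT => w; first exact: measure_ge0.
  apply: (le_trans (loss_le w)); rewrite EFinD EFinM -sumEFin.
  by rewrite (eq_bigr (fun k => (expR (kappa * n%:R * dist k))%:E *
    (f k w)%:E)%E).
have mterm k : measurable_fun setT
    (fun w => ((expR (kappa * n%:R * dist k))%:E * (f k w)%:E)%E).
  by apply: emeasurable_funM => //; apply/measurable_EFinP.
have term0 k w : (0 <= (expR (kappa * n%:R * dist k))%:E * (f k w)%:E)%E.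
  by rewrite mule_ge0// lee_fin expR_ge0.
have msum : measurable_fun setT (fun w =>
    (\sum_(k : cand) (expR (kappa * n%:R * dist k))%:E * (f k w)%:E)%E).
  exact: emeasurable_sum.
have sum0 w : (0 <= \sum_(k : cand)
    (expR (kappa * n%:R * dist k))%:E * (f k w)%:E)%E.
  by apply: sume_ge0.
rewrite ge0_integralD//; first last.
- by apply: emeasurable_funM.
- by move=> w _; rewrite mule_ge0.
rewrite integral_probability_cst ge0_integralZl//.
rewrite ge0_integral_sum//.
rewrite -/c1 -/c2 (EFinD c1) leeD2l// (EFinM c2) lee_wpmul2l//.
apply: (@le_trans _ _ (\sum_(k : cand) (expR (4 * kappa + 4 * rho))%:E)%E).
  apply: lee_sum => k _; rewrite ge0_integralZl//; first last.
  - by move=> w _; rewrite lee_fin expR_ge0.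
  - exact/measurable_EFinP.
  apply: (@le_trans _ _ ((expR (kappa * n%:R * dist k))%:E *
    (expR (- (kappa * n%:R * dist k)) * expR (4 * kappa + 4 * rho))%:E))%E.
    by rewrite lee_wpmul2l// lee_fin expR_ge0.
  by rewrite -EFinM mulrA -expRD subrr expR0 mul1r.
rewrite sumEFin lee_fin sumr_const card_prod card_ord -natrX mulnn.
by rewrite -[leLHS]mulr_natl.
Qed.

Lemma minimax_risk_le (r : R) : 0 <= r ->
  (minimax_risk X xi segments <=
   (2 / n%:R + r + (kappa * n%:R)^-1 * expR (- (kappa * n%:R * r)) *
      (n.+1%:R ^+ 2 * expR (4 * kappa + 4 * rho)))%:E)%E.
Proof.
move=> r0; apply: (@le_trans _ _ (risk X xi grid_estimator segments)).
  by apply: ereal_inf_lbound; exists grid_estimator => //; exact: grid_estimatorP.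
apply: ge_ereal_sup => _ [_ [a [b [a0 ab b1 ->]]] <-].
exact: expected_loss_grid_estimator.
Qed.

End upper_bound.

(** * Choice of constants for the two rates *)

Theorem theorem8 (R : realType) (sigma : R) (sigma_gt0 : 0 < sigma) :
  exists c C : R, [/\ 0 < c, 0 < C &
    \forall n \near \oo,
      forall (d : measure_display) (T : measurableType d)
        (P : probability T R) (X xi : 'I_n -> {RV P >-> R}),
        deterministic_design X \/ random_design X ->
        iid_with_law xi (normal_prob 0 sigma) ->
        independent2 P (joint X) (joint xi) ->
        ((c * (ln n%:R / n%:R))%:E <= minimax_risk X xi segments)%E /\
        (minimax_risk X xi segments <= (C * (ln n%:R / n%:R))%:E)%E].
Proof.
pose k1 : R := expR (sigma ^+ 2)^-1 - 1.
have k1_gt0 : 0 < k1.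
  by rewrite subr_gt0 -[ltLHS]expR0 ltr_expR invr_gt0 exprn_gt0.
pose lam : R := (4 * sigma ^+ 2)^-1.
pose kappa : R := 1 - expR (- (lam / 2)).
pose rho : R := expR (3 * lam / 2).
have lam_gt0 : 0 < lam by rewrite invr_gt0 mulr_gt0// exprn_gt0.
have kappa_gt0 : 0 < kappa.
  by rewrite subr_gt0 -[ltRHS]expR0 ltr_expR oppr_lt0 divr_gt0.
(* With [delta = c0 * ln n / n], the second moment bound is [expR k1] times the square root of
   [n]. *)
pose c0 : R := (2 * k1)^-1.
have c0_gt0 : 0 < c0 by rewrite invr_gt0 mulr_gt0.
pose D : R := expR (4 * kappa + 4 * rho).
(* The summands account for rounding, for the threshold [r] chosen below, and for the exponential
   moment, using [(n + 1) ^ 2 <= 4 * n ^ 2]. *)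
pose C : R := 2 + 2 / kappa + 4 * D / kappa.
have D_gt0 : 0 < D by exact: expR_gt0.
have C_gt0 : 0 < C.
  by rewrite !addr_gt0 ?divr_gt0 ?mulr_gt0.
exists (c0 / 4), C; split => //; first by rewrite divr_gt0.
pose E : R := expR k1.
have E_ge1 : 1 <= E by rewrite -[leLHS]expR0 ler_expR ltW.
(* Chosen so that [M * delta <= K * u ^ 3 / n] below, where [u ^ 4 = n]; the segments then fit into
   [[0, 1]] once [K <= u]. *)
pose K : R := 17 * E * c0 * 4.
have K_ge0 : 0 <= K by rewrite !mulr_ge0 ?expR_ge0// ltW.
(* The first bound gives [1 <= ln n], the second [K ^ 4 <= n]. *)
exists (maxn (Num.truncn (expR 1 : R)).+1 (Num.truncn (K ^+ 4)).+1) => //.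
move=> n /=; rewrite geq_max => /andP[n_e n_K].
have n_gt0 : (0 < n)%N by exact: leq_trans n_e.
have nR : 0 < n%:R :> R by rewrite ltr0n.
have e_n : expR 1 <= n%:R :> R.
  by apply/ltW/(lt_le_trans (truncnS_gt _)); rewrite ler_nat.
have K_n : K ^+ 4 <= n%:R.
  by apply/ltW/(lt_le_trans (truncnS_gt _)); rewrite ler_nat.
have ln_ge1 : 1 <= ln n%:R :> R.
  by rewrite -[leLHS](expRK 1) ler_ln ?posrE ?expR_gt0.
set L := ln n%:R in ln_ge1 *.
have nE : n%:R = expR L by rewrite lnK// posrE.
move=> d T P X xi design xi_iid Xxi; split.
  (* The fourth root of [n]: [M] is of order [u ^ 2], which leaves room for the crude bound
     [ln n <= 4 * u]. *)
  pose u : R := expR (L / 4).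
  have u4 : u ^+ 4 = n%:R.
    by rewrite /u -expRM_natl nE; congr expR; field.
  have u_gt0 : 0 < u by exact: expR_gt0.
  have Ku : K <= u.
    by rewrite -(@ler_pXn2r _ 4) ?nnegrE// ?u4// ltW.
  have Lu : L <= 4 * u.
    by have := expR_ge1Dx (L / 4); rewrite -/u; lra.
  pose w := 16 * E * u ^+ 2.
  have w_ge0 : 0 <= w by rewrite !mulr_ge0 ?sqr_ge0 ?expR_ge0.
  have u_ge1 : 1 <= u.
    by rewrite -[leLHS]expR0 ler_expR divr_ge0// (le_trans _ ln_ge1).
  have Eu : 1 <= E * u ^+ 2 by rewrite mulr_ege1 ?exprn_ege1.
  (* Rounding up adds at most [1 <= E * u ^ 2], which turns [16] into [17]. *)
  pose M := (Num.truncn w).+1.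
  have wM : w <= M%:R by exact/ltW/truncnS_gt.
  have Mw : M%:R <= 17 * E * u ^+ 2.
    have := truncn_le w; rewrite w_ge0 /M -natr1 => tw.
    by move: tw Eu; rewrite /w; lra.
  have := minimax_risk_ge sigma_gt0 xi_iid Xxi n_gt0 design (M := M)
    (delta := c0 * (L / n%:R)).
  rewrite mulrAC; apply => //.
  - by rewrite mulr_gt0// divr_gt0// (lt_le_trans _ ln_ge1).
  - apply: (@le_trans _ _ (17 * E * u ^+ 2 * (c0 * (4 * u / n%:R)))).
      apply: ler_pM => //.
        by rewrite mulr_ge0 ?divr_ge0// ltW// (lt_le_trans _ ln_ge1).
      by rewrite ler_pM2l// ler_pM2r ?invr_gt0.
    rewrite (_ : _ * _ = K * u ^+ 3 / n%:R); last by rewrite /K; ring.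
    by rewrite ler_pdivrMr// mul1r -u4 (exprS u 3) ler_pM2r ?exprn_gt0.
  - apply: le_trans wM; rewrite /w -/k1 -mulrA ler_pM2l//.
    rewrite /E /u -expRM_natl -expRD ler_expR.
    rewrite le_eqVlt; apply/orP; left; apply/eqP; rewrite /c0; field.
    by rewrite !gt_eqF.
(* For this [r] the exponential factor is [n ^ -2], which offsets the number of candidates. *)
have r_ge0 : 0 <= 2 * L / (kappa * n%:R).
  by rewrite divr_ge0 ?mulr_ge0 ?(ltW kappa_gt0)// (le_trans _ ln_ge1).
apply: (le_trans (minimax_risk_le sigma_gt0 xi_iid Xxi n_gt0 design r_ge0)).
rewrite lee_fin -/lam -/kappa -/rho -/D.
rewrite (_ : kappa * n%:R * (2 * L / (kappa * n%:R)) = 2 * L); last first.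
  by field; rewrite !gt_eqF.
have -> : expR (- (2 * L)) = (n%:R ^+ 2)^-1.
  by rewrite expRN expRM_natl -nE.
have n1 : n.+1%:R ^+ 2 <= 4 * n%:R ^+ 2 :> R.
  rewrite -natr1.
  have : 1 <= n%:R :> R by rewrite ler1n.
  by nra.
(* The first and last terms are of order [1 / n]; as [1 <= L], they may be multiplied by [L]. *)
apply: (@le_trans _ _ (2 / n%:R * L + 2 * L / (kappa * n%:R) +
    (kappa * n%:R)^-1 * (n%:R ^+ 2)^-1 * (4 * n%:R ^+ 2 * D) * L)); last first.
  rewrite le_eqVlt; apply/orP; left; apply/eqP; rewrite /C; field.
  by rewrite !gt_eqF.
rewrite lerD ?lerD//.
  by rewrite ler_peMr// divr_ge0.
rewrite -[leLHS]mulr1 ler_pM//.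
  by rewrite !mulr_ge0 ?invr_ge0 ?mulr_ge0 ?exprn_ge0 ?(ltW kappa_gt0)
    ?(ltW D_gt0).
rewrite ler_wpM2l//; last by rewrite ler_wpM2r// ltW.
by rewrite mulr_ge0 ?invr_ge0 ?mulr_ge0 ?exprn_ge0 ?(ltW kappa_gt0).
Qed.
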